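(* Let $\Gamma$ be a distance-regular graph with vertex set $X$ and diameter $D\ge 3$, let $\{E_i\}_{i=0}^D$ be a $Q$-polynomial ordering of its primitive idempotents, let $x\in X$, and let $T^{\mathbb{R}}=T^{\mathbb{R}}(x)$ and $T^{\mathbb{C}}=T^{\mathbb{C}}(x)$ be the Terwilliger algebras of $\Gamma$ with respect to $x$ over $\mathbb{R}$ and over $\mathbb{C}$. Let $W$ be an irreducible $T^{\mathbb{R}}$-module. Then the complexification $W^{\mathbb{C}}$ is an irreducible $T^{\mathbb{C}}$-module.
   Context: $\Gamma$ is a finite, undirected, connected graph without loops or multiple edges, with vertex set $X$, path-length distance $\partial$ and diameter $D=\max\{\partial(y,z)\mid y,z\in X\}$. It is distance-regular: for all $0\le h,i,j\le D$ and all $y,z\in X$ with $\partial(y,z)=h$, the number $p^h_{i,j}=|\{w\in X\mid \partial(y,w)=i,\ \partial(z,w)=j\}|$ depends only on $h,i,j$. All matrices have rows and columns indexed by $X$. The adjacency matrix $A$ has $D+1$ distinct real eigenvalues $\theta_0,\dots,\theta_D$, with $\theta_0$ equal to the valency; the primitive idempotent $E_i$ is the matrix of the orthogonal projection onto the $\theta_i$-eigenspace of $A$. With $\circ$ the entrywise product, the Krein parameters $q^h_{i,j}$ are defined by $E_i\circ E_j=|X|^{-1}\sum_{h=0}^D q^h_{i,j}E_h$. The ordering $\{E_i\}_{i=0}^D$ is $Q$-polynomial if for all $0\le h,i,j\le D$: $q^h_{i,j}=0$ whenever one of $h,i,j$ is greater than the sum of the other two, and $q^h_{i,j}\ne0$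 whenever one of $h,i,j$ equals the sum of the other two. For $0\le i\le D$, $E_i^*=E_i^*(x)$ is the diagonal matrix with $(y,y)$-entry $1$ if $\partial(x,y)=i$ and $0$ otherwise. For $\mathbb{F}\in\{\mathbb{R},\mathbb{C}\}$, the Terwilliger algebra $T^{\mathbb{F}}$ is the $\mathbb{F}$-subalgebra of the matrix algebra $\mathrm{Mat}_X(\mathbb{F})$ generated by $A$ and $E_0^*,\dots,E_D^*$. A $T^{\mathbb{F}}$-module is a subspace $W$ of $\mathbb{F}^X$ with $T^{\mathbb{F}}W\subseteq W$; it is irreducible if $W\ne0$ and it contains no $T^{\mathbb{F}}$-module other than $0$ and $W$. One has $T^{\mathbb{C}}=T^{\mathbb{R}}+\boldsymbol{i}T^{\mathbb{R}}=T^{\mathbb{R}}\otimes_{\mathbb{R}}\mathbb{C}$, where $\boldsymbol{i}=\sqrt{-1}$. The complexification of a $T^{\mathbb{R}}$-module $W$ is the $T^{\mathbb{C}}$-module $W^{\mathbb{C}}=W\otimes_{\mathbb{R}}\mathbb{C}=W+\boldsymbol{i}W\subseteq\mathbb{C}^X$ (sum direct over $\mathbb{R}$). *)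

(* Defs.v *)
From HB Require Import structures.
From mathcomp Require Import all_boot all_order all_algebra.
From mathcomp Require Import complex.
From mathcomp Require Import reals.

Set Implicit Arguments.
Unset Strict Implicit.
Unset Printing Implicit Defensive.

Import Order.TTheory GRing.Theory Num.Theory.

Local Open Scope ring_scope.
Local Open Scope complex_scope.

Section Graph.
Variables (X : finType) (e : rel X).

Definition walk (n : nat) (y z : X) : bool :=
  [exists p : n.-tuple X, path e y p && (last y p == z)].

(* In a connected graph a shortest walk has fewer than #|X| edges, so the
   search below finds it; on disconnected pairs the value is #|X|. *)
Definition gdist (y z : X) : nat := find (fun n => walk n y z) (iota 0 #|X|).

Definition diameter : nat := (\max_(y : X) \max_(z : X) gdist y z)%N.

Definition simple_connected_graph : Prop :=
  [/\ symmetric e, irreflexive e & forall y z, connect e y z].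

Definition distance_regular : Prop :=
  simple_connected_graph /\
  exists p : nat -> nat -> nat -> nat,
    forall h i j : nat,
      (h <= diameter)%N -> (i <= diameter)%N -> (j <= diameter)%N ->
    forall y z : X, gdist y z = h ->
      #|[set w | (gdist y w == i) && (gdist z w == j)]| = p h i j.

Lemma gdistP (y z : X) : connect e y z ->
  walk (gdist y z) y z /\ forall n, walk n y z -> (gdist y z <= n)%N.
Proof.
move=> /connectP[p0 /shortenP[p pP up _] zE].
have wp : walk (size p) y z.
  by apply/existsP; exists (in_tuple p); rewrite pP zE eqxx.
have sp : (size p < #|X|)%N by rewrite -[(size p).+1]/(size (y :: p)) -(card_uniqP up) max_card.
have hs : has (fun n => walk n y z) (iota 0 #|X|).
  by apply/hasP; exists (size p); rewrite // mem_iota.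
have lt_d : (gdist y z < #|X|)%N.
  by move: hs; rewrite has_find size_iota.
split; first by have := nth_find 0%N hs; rewrite nth_iota.
move=> n wn; rewrite leqNgt; apply/negP => lt_n.
have := before_find 0%N lt_n; rewrite nth_iota ?add0n ?wn //.
exact: ltn_trans lt_n lt_d.
Qed.

End Graph.

(* Matrices in Mat_X(F) are indexed by 'I_#|X|, the index k standing for the
   vertex enum_val k; F^X is the space of column vectors. *)
Section Matrices.
Variables (F : fieldType) (X : finType) (e : rel X).

Definition adjacency : 'M[F]_#|X| :=
  \matrix_(k, l) (e (enum_val k) (enum_val l))%:R.

Definition dual_idempotent (x : X) (i : nat) : 'M[F]_#|X| :=
  diag_mx (\row_k (gdist e x (enum_val k) == i)%:R).

End Matrices.

Inductive generated_subalgebra (F : fieldType) (n : nat)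
    (G : 'M[F]_n -> Prop) : 'M[F]_n -> Prop :=
  | gen_incl B of G B : generated_subalgebra G B
  | gen_one : generated_subalgebra G 1%:M
  | gen_scale a B of generated_subalgebra G B : generated_subalgebra G (a *: B)
  | gen_add B C of generated_subalgebra G B & generated_subalgebra G C :
      generated_subalgebra G (B + C)
  | gen_mul B C of generated_subalgebra G B & generated_subalgebra G C :
      generated_subalgebra G (B *m C).

Definition terwilliger (F : fieldType) (X : finType) (e : rel X) (x : X) :
    'M[F]_#|X| -> Prop :=
  generated_subalgebra (fun B => B = adjacency F e \/
    exists2 i : nat, (i <= diameter e)%N & B = dual_idempotent F e x i).

Section Modules.
Variables (F : fieldType) (n : nat) (T : 'M[F]_n -> Prop).

Definition is_module (W : {vspace 'cV[F]_n}) : Prop :=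
  forall (B : 'M[F]_n) (v : 'cV[F]_n), T B -> v \in W -> B *m v \in W.

Definition irreducible_module (W : {vspace 'cV[F]_n}) : Prop :=
  [/\ is_module W, W <> 0%VS &
      forall U : {vspace 'cV[F]_n}, is_module U -> (U <= W)%VS ->
        U = 0%VS \/ U = W].

End Modules.

Section Idempotents.
Variables (R : realType) (X : finType) (e : rel X) (D : nat).

Definition orthogonal_projection (n : nat) (V : {vspace 'cV[R]_n})
    (P : 'M[R]_n) : Prop :=
  (forall v, v \in V -> P *m v = v) /\
  (forall w : 'cV[R]_n, (forall v, v \in V -> v^T *m w = 0) -> P *m w = 0).

Definition primitive_idempotents (E : 'I_D.+1 -> 'M[R]_#|X|) : Prop :=
  let A := linfun (mulmx (adjacency R e)) : 'End('cV[R]_#|X|) in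
  exists theta : 'I_D.+1 -> R,
    [/\ injective theta,
        forall a : R, passmx.leigenvalue A a <-> exists i, a = theta i,
        forall y : X, theta ord0 = #|[set z | e y z]|%:R &
        forall i, orthogonal_projection (passmx.leigenspace A (theta i)) (E i)].

Definition krein_parameters (E : 'I_D.+1 -> 'M[R]_#|X|)
    (q : 'I_D.+1 -> 'I_D.+1 -> 'I_D.+1 -> R) : Prop :=
  forall i j, map2_mx *%R (E i) (E j) =
    #|X|%:R^-1 *: \sum_(h < D.+1) q h i j *: E h.

(* The primitive idempotents are linearly independent, so q is unique. *)
Definition Q_polynomial (E : 'I_D.+1 -> 'M[R]_#|X|) : Prop :=
  exists2 q, krein_parameters E q &
    forall h i j : 'I_D.+1,
      ([|| i + j < h, h + j < i | h + i < j]%N -> q h i j = 0) /\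
      ([|| h == i + j :> nat, i == h + j :> nat | j == h + i :> nat]%N ->
        q h i j <> 0).

End Idempotents.

Definition complexification (R : realType) (n : nat)
    (W : {vspace 'cV[R]_n}) : {vspace 'cV[R[i]]_n} :=
  <<[seq map_mx (real_complex R) w | w <- vbasis W]>>%VS.

Lemma complexificationP (R : realType) (n : nat) (W : {vspace 'cV[R]_n})
    (v : 'cV[R[i]]_n) :
  v \in complexification W <->
  exists u w : 'cV[R]_n, [/\ u \in W, w \in W &
    v = map_mx (real_complex R) u + 'i *: map_mx (real_complex R) w].
Proof.
pose c := map_mx (real_complex R) : 'cV[R]_n -> 'cV[R[i]]_n.
have cW u : u \in W -> c u \in complexification W.
  move=> /coord_vbasis ->; rewrite /c raddf_sum; apply: memv_suml => k _ /=.
  rewrite map_mxZ; apply: memvZ; apply: memv_span; apply: map_f.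
  by apply: mem_nth; rewrite size_tuple.
split=> [|[u [w [uW wW ->]]]]; last by rewrite memvD ?memvZ ?cW.
pose f (k : 'I_(\dim W)) := (vbasis W)`_k.
move=> /(@coord_span _ _ _ (map_tuple c (vbasis W))) ->.
pose a k := coord (map_tuple c (vbasis W)) k v.
exists (\sum_k complex.Re (a k) *: f k), (\sum_k complex.Im (a k) *: f k).
have fW k : f k \in W by apply: vbasis_mem; rewrite mem_nth ?size_tuple.
split; try by apply: memv_suml => k _; apply: memvZ.
rewrite !raddf_sum -big_split /=; apply: eq_bigr => k _.
rewrite (nth_map 0) ?size_tuple // !map_mxZ scalerA -scalerDl.
congr (_ *: _); rewrite -/(a k); case: (a k) => re im /=.
by simpc.
Qed.

(* Main.v *)
(* Let A^* = diag(E_1(x, .)). In the Q-polynomial ordering A and A^* act on the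
   eigenspaces of each other in a block tridiagonal way, so that
   E_i^* p(A) E_j^* = 0 and E_i p(A^* ) E_j = 0 whenever deg p < |i - j|. Let W
   be irreducible over R and let r be minimal with E_r^* W <> 0. From these
   vanishing rules alone one gets that on W the algebra E_r^* T E_r^* is spanned
   by products of the elements E_r^* p(A) E_r^*, and that these elements commute
   (Nomura and Terwilliger's theorem on tridiagonal pairs). They are real
   symmetric, hence have real eigenvectors in E_r^* W, and by irreducibility of W
   they act as scalars; so E_r^* W is a real line, spanned by some u. A nonzero
   T^C-submodule U of W^C either contains u, and then it is everything, or is
   killed by E_r^* T, and then the real and imaginary parts of its elements lie
   in the proper T^R-submodule of W killed by E_r^* T, which is 0. *)
Require Import Defs.
From mathcomp Require Import all_boot all_order all_algebra.
From mathcomp Require Import complex.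
From mathcomp Require Import reals.
From mathcomp Require Import boolp spectral zify ring.

Set Implicit Arguments.
Unset Strict Implicit.
Unset Printing Implicit Defensive.

Import Order.TTheory GRing.Theory Num.Theory.

Local Open Scope ring_scope.

(** * Alternating words in two operators under the vanishing rules *)

Section Words.
Variables (F : fieldType) (n D : nat).
Variables (th : bool -> 'I_D.+1 -> F) (g : bool -> 'I_D.+1 -> 'M[F]_n).

(* With [g b] the eigenprojections of A (b = true) or A^* (b = false) and [th b]
   the eigenvalues, this is p(A), respectively p(A^* ). *)
Definition speval (b : bool) (p : {poly F}) : 'M[F]_n :=
  \sum_i p.[th b i] *: g b i.

Lemma spevalD b p q : speval b (p + q) = speval b p + speval b q.
Proof.
by rewrite /speval -big_split; apply: eq_bigr => i _; rewrite hornerD scalerDl.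
Qed.

Lemma spevalZ b a p : speval b (a *: p) = a *: speval b p.
Proof.
by rewrite /speval scaler_sumr; apply: eq_bigr => i _; rewrite hornerZ scalerA.
Qed.

Lemma speval0 b : speval b 0 = 0.
Proof. by rewrite /speval big1 // => i _; rewrite horner0 scale0r. Qed.

(** Windows of consecutive indices serve as interpolation nodes; this bounds the degrees. *)
Lemma size_filter_ord (lo m : nat) :
  (size [seq j : 'I_D.+1 <- enum 'I_D.+1 | lo <= j < lo + m] <= m)%N.
Proof.
rewrite -(size_map val) -[leqRHS](size_iota lo); apply: uniq_leq_size.
  by rewrite (map_inj_uniq val_inj) filter_uniq // enum_uniq.
by move=> x /mapP[j]; rewrite mem_filter mem_iota => /andP[? _] ->.
Qed.

Hypothesis th_inj : forall b, injective (th b).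

(** Newton interpolation: a multiple of the product vanishing at the earlier nodes corrects the
    value at a new one. *)
Lemma interpolation b (s : seq 'I_D.+1) (h : 'I_D.+1 -> F) :
  exists2 p : {poly F}, (size p <= size s)%N &
    {in s, forall i, p.[th b i] = h i}.
Proof.
elim: s => [|x s [p sp hp]]; first by exists 0; rewrite ?size_poly0.
have [xs|xs] := boolP (x \in s).
  exists p => [|i]; first exact: leq_trans sp _.
  by rewrite inE => /predU1P[->|]; apply: hp.
pose w := \prod_(a <- [seq th b j | j <- s]) ('X - a%:P).
have sw : size w = (size s).+1 by rewrite size_prod_XsubC size_map.
have w0 i : i \in s -> w.[th b i] = 0.
  by move=> si; apply/rootP; rewrite root_prod_XsubC map_f.
have wx : w.[th b x] != 0.
  by rewrite -rootE root_prod_XsubC mem_map //; apply: th_inj.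
exists (p + ((h x - p.[th b x]) / w.[th b x]) *: w).
  rewrite (leq_trans (size_polyD _ _)) // geq_max (leq_trans sp) //=.
  by rewrite (leq_trans (size_scale_leq _ _)) // sw.
move=> i; rewrite inE hornerD hornerZ => /predU1P[->|si].
  by rewrite divfK // addrC subrK.
by rewrite (w0 i si) mulr0 addr0 hp.
Qed.

Lemma speval_delta b i : exists p, g b i = speval b p.
Proof.
have [p _ pP] := interpolation b (enum 'I_D.+1) (fun j => (j == i)%:R).
exists p; rewrite /speval (bigD1 i) //= pP ?mem_enum // eqxx scale1r big1 ?addr0 //.
by move=> j /negPf ji; rewrite pP ?mem_enum // ji scale0r.
Qed.

(** As [size p] is the degree plus one, a nonzero [p] has degree less than the distance of [j] and
    [l]. *)
Hypothesis g_band : forall b (j l : 'I_D.+1) (p : {poly F}),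
  (size p + j <= l)%N || (size p + l <= j)%N ->
  g b j *m speval (~~ b) p *m g b l = 0.

Lemma speval_mulr (M : 'M[F]_n) b p :
  M *m speval b p = \sum_i p.[th b i] *: (M *m g b i).
Proof. by rewrite mulmx_sumr; apply: eq_bigr => i _; rewrite scalemxAr. Qed.

Lemma speval_mul_sum b p q (M : 'M[F]_n) : speval b p *m M *m speval b q =
  \sum_i \sum_k (p.[th b i] * q.[th b k]) *: (g b i *m M *m g b k).
Proof.
rewrite /speval !mulmx_suml; apply: eq_bigr => i _.
rewrite mulmx_sumr; apply: eq_bigr => k _.
by rewrite -!scalemxAl -scalemxAr scalerA.
Qed.

Section Band.
Variable S : 'M[F]_n -> Prop.
Hypotheses (S0 : S 0) (SD : forall M N, S M -> S N -> S (M + N)).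
Hypothesis SZ : forall a M, S M -> S (a *: M).

Lemma closed_sum (I : finType) (M : I -> 'M[F]_n) :
  (forall i, S (M i)) -> S (\sum_i M i).
Proof. by move=> SM; apply: big_ind => // i _; apply: SM. Qed.

Lemma closed_isolate (I : finType) (i0 : I) (c : I -> F) (M : I -> 'M[F]_n) :
  S (\sum_i c i *: M i) -> c i0 = 1 ->
  (forall i, i != i0 -> c i = 0 \/ S (M i)) -> S (M i0).
Proof.
move=> Ssum c1 Sr; have -> : M i0 = \sum_i c i *: M i +
    (-1) *: \sum_i (if i != i0 then c i *: M i else 0).
  by rewrite -big_mkcond scaleN1r (bigD1 i0) //= c1 scale1r addrK.
apply: SD => //; apply: SZ; apply: closed_sum => i.
by case: ifP => [/Sr[->|/SZ//]|_] //; rewrite scale0r.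
Qed.

(* Dually: every function on the band |i - k| <= m of the grid of pairs of
   eigenvalues (x_i, x_k) is a combination of functions x_i^t c(x_k) with t <= m
   and a(x_i) x_k^t with t < m; these are determined by triangular elimination
   along min(i, k). *)
Lemma band_span b (q : {poly F}) m : (size q <= m.+1)%N ->
  (forall p1 p2 : {poly F}, (size p1 <= m.+1)%N \/ (size p2 <= m)%N ->
     S (speval b p1 *m speval (~~ b) q *m speval b p2)) ->
  forall p1 p2, S (speval b p1 *m speval (~~ b) q *m speval b p2).
Proof.
move=> sq Sq p1 p2; rewrite speval_mul_sum.
pose Z i k := g b i *m speval (~~ b) q *m g b k.
suff SZik N (i k : 'I_D.+1) : minn i k = N -> S (Z i k).
  by apply: closed_sum => i; apply: closed_sum => k; apply: SZ; apply: SZik.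
elim/ltn_ind: N i k => N IH.
(* Column [N]: rows [j < N] are covered by induction on the minimum and rows [j > N + m] vanish, so
   a polynomial of degree at most [m] isolates one of the [m + 1] other entries. *)
have col (i k : 'I_D.+1) : k = N :> nat -> (N <= i)%N -> S (Z i k).
  move=> kN Ni; have [le_i|gt_i] := leqP i (N + m); last first.
    rewrite /Z g_band //; apply/orP; right; lia.
  pose s := [seq j : 'I_D.+1 <- enum 'I_D.+1 | N <= j < N + m.+1]%N.
  have [p sp hp] := interpolation b s (fun j => (j == i)%:R).
  apply: (@closed_isolate _ i (fun j => p.[th b j]) (fun j => Z j k)).
  - have [pk pkE] := speval_delta b k.
    suff -> : \sum_j p.[th b j] *: Z j k =
        speval b p *m speval (~~ b) q *m speval b pk.
      by apply: Sq; left; apply: leq_trans sp (size_filter_ord _ _).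
    rewrite -pkE [speval b p]/speval !mulmx_suml; apply: eq_bigr => j _.
    by rewrite -!scalemxAl.
  - by rewrite hp ?eqxx // mem_filter mem_enum andbT; lia.
  move=> j /negPf ji; have [jN|Nj] := ltnP j N.
    by right; apply: (IH j) => //; lia.
  have [js|js] := ltnP j (N + m.+1).
    by left; rewrite hp ?ji // mem_filter mem_enum andbT; lia.
  right; rewrite /Z g_band //; apply/orP; right; lia.
move=> i k; case: leqP => [ik iN|ki kN]; last by apply: col => //; lia.
have [ki|ki] := eqVneq (k : nat) i; first by apply: col; lia.
have [le_k|gt_k] := leqP k (N + m); last first.
  rewrite /Z g_band //; apply/orP; left; lia.
(* In row [N] the entry at column [N] is already settled by [col], so only [m] nodes remain and
   degree less than [m] suffices. *)
pose s := [seq j : 'I_D.+1 <- enum 'I_D.+1 | N.+1 <= j < N.+1 + m]%N.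
have [p sp hp] := interpolation b s (fun j => (j == k)%:R).
apply: (@closed_isolate _ k (fun j => p.[th b j]) (fun j => Z i j)).
- have [pk pkE] := speval_delta b i.
  suff -> : \sum_j p.[th b j] *: Z i j =
      speval b pk *m speval (~~ b) q *m speval b p.
    by apply: Sq; right; apply: leq_trans sp (size_filter_ord _ _).
  rewrite -pkE [speval b p]/speval mulmx_sumr; apply: eq_bigr => j _.
  by rewrite -!scalemxAr.
- by rewrite hp ?eqxx // mem_filter mem_enum andbT; lia.
move=> j /negPf ji; have [jN|Nj] := ltnP j N.
  by right; apply: (IH j) => //; lia.
have [js|js] := ltnP j (N.+1 + m); last first.
  right; rewrite /Z g_band //; apply/orP; left; lia.
have [jN|jN] := eqVneq (j : nat) N; first by right; apply/col; lia.
by left; rewrite hp ?ji // mem_filter mem_enum andbT; lia.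
Qed.

End Band.

(** * The corner at the lowest index [r] *)

Variable r : 'I_D.+1.
Hypothesis g_bottom : forall j : 'I_D.+1, (j < r)%N -> g false j = 0.

Let fr := g false r.

(** The linear span of the products [fr p1(A) fr p2(A) fr ... fr], in which neighbouring factors
    share one [fr]. *)
Inductive corner_span : 'M[F]_n -> Prop :=
  | corner_base p : corner_span (fr *m speval true p *m fr)
  | corner_mul p M of corner_span M : corner_span (fr *m speval true p *m M)
  | corner0 : corner_span 0
  | cornerD M N of corner_span M & corner_span N : corner_span (M + N)
  | cornerZ a M of corner_span M : corner_span (a *: M).

Lemma corner_mulr p M : corner_span M -> corner_span (M *m speval true p *m fr).
Proof.
elim=> [q|q N _ IH||N N' _ IH _ IH'|a N _ IH].
- by rewrite -!mulmxA mulmxA; apply: corner_mul; rewrite mulmxA; apply: corner_base.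
- rewrite -!mulmxA mulmxA; apply: corner_mul; by rewrite mulmxA.
- by rewrite !mul0mx; apply: corner0.
- by rewrite !mulmxDl; apply: cornerD.
by rewrite -!scalemxAl; apply: cornerZ.
Qed.

Fixpoint word_mx (b : bool) (s : seq {poly F}) : 'M[F]_n :=
  if s is p :: s' then speval b p *m word_mx (~~ b) s' else 1%:M.

Lemma word_mx_cat b s1 s2 : word_mx b (s1 ++ s2) =
  word_mx b s1 *m word_mx (b (+) odd (size s1)) s2.
Proof.
elim: s1 b => [|p s1 IH] b /=; first by rewrite mul1mx addbF.
by rewrite IH mulmxA addNb addbN.
Qed.

(** Next to [fr] and a polynomial in [A] of degree at most [m], only the nodes [r, ..., r + m] of
    [B] matter: lower ones vanish by [g_bottom], higher ones by [g_band]. [B'] agrees with [B] at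
    the upper [m] of them, and [c] corrects the value at [r]. *)
Lemma edge_split (q B : {poly F}) m : (size q <= m.+1)%N ->
  exists (B' : {poly F}) (c : F), [/\ (size B' <= m)%N,
    fr *m speval true q *m speval false B =
      fr *m speval true q *m speval false B' + c *: (fr *m speval true q *m fr) &
    speval false B *m speval true q *m fr =
      speval false B' *m speval true q *m fr + c *: (fr *m speval true q *m fr)].
Proof.
move=> sq; pose s := [seq j : 'I_D.+1 <- enum 'I_D.+1 | r.+1 <= j < r.+1 + m]%N.
have [B' sB' hB'] := interpolation false s (fun j => B.[th false j]).
exists B', (B - B').[th false r].
have z (j : 'I_D.+1) : j != r -> (B - B').[th false j] = 0 \/
    fr *m speval true q *m g false j = 0 /\ g false j *m speval true q *m fr = 0.
  rewrite -val_eqE => /= jr; have [ltj|rj] := ltnP j r.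
    by right; rewrite g_bottom // mulmx0 !mul0mx.
  have [js|js] := ltnP j (r.+1 + m).
    left; rewrite hornerD hornerN hB' ?subrr // mem_filter mem_enum andbT; lia.
  right; rewrite !(@g_band false) //; apply/orP; [right|left]; lia.
have E : B = B' + (B - B') by rewrite addrC subrK.
split; first exact: leq_trans sB' (size_filter_ord _ _).
  rewrite {1}E spevalD mulmxDr; congr (_ + _).
  rewrite [speval false (_ - _)]/speval mulmx_sumr.
  rewrite (bigD1 r) //= big1 ?addr0 -?scalemxAr // => j /z[->|[zj _]].
    by rewrite scale0r mulmx0.
  by rewrite -scalemxAr zj scaler0.
rewrite {1}E spevalD !mulmxDl; congr (_ + _).
rewrite [speval false (_ - _)]/speval !mulmx_suml.
rewrite (bigD1 r) //= big1 ?addr0 -?scalemxAl // => j /z[->|[_ zj]].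
  by rewrite scale0r !mul0mx.
by rewrite -!scalemxAl zj scaler0.
Qed.

(* Induction on the length of the word, then on a bound m for the degree of
   some letter, then on the position of that letter: the band lemma moves a
   letter of degree at most m to the left or creates one of smaller degree,
   and at either end of the word such a letter allows to split off a factor. *)
Lemma word_corner_span s : odd (size s) -> corner_span (fr *m word_mx true s *m fr).
Proof.
have [N] := ubnP (size s); elim: N s => // N IHN s; rewrite ltnS => sN os.
have short s' : (size s' < size s)%N -> odd (size s') ->
    corner_span (fr *m word_mx true s' *m fr).
  by move=> ss; apply: IHN; apply: leq_trans ss sN.
suff key m t s1 (q : {poly F}) s2 : size s1 = t -> size (s1 ++ q :: s2) = size s ->
    (size q <= m.+1)%N -> corner_span (fr *m word_mx true (s1 ++ q :: s2) *m fr).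
  case: s os {IHN sN short} key => // p s _ key.
  exact: (key (size p) 0%N [::]).
elim/ltn_ind: m t s1 q s2 => m IHm; elim/ltn_ind => t IHt s1 q s2 st ssz sq.
case/lastP: s1 => [|s1 p1] in st ssz *.
  case: s2 => [|B s2] /= in ssz *; first by rewrite mulmx1; apply: corner_base.
  have [B' [c [sB' E _]]] := edge_split B sq.
  rewrite -mulmxA mulmxA !mulmxA E !mulmxDl; apply: cornerD; last first.
    rewrite -!scalemxAl; apply: cornerZ.
    rewrite -!mulmxA mulmxA; apply: corner_mul; rewrite mulmxA.
    by apply: short; [rewrite -ssz | move: os; rewrite -ssz /= negbK].
  case: m => [|m] in IHm sB' {sq E IHt} *.
    move: sB'; rewrite leqn0 size_poly_eq0 => /eqP ->.
    by rewrite speval0 mulmx0 !mul0mx; apply: corner0.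
  have := IHm m (ltnSn m) 1%N [:: q] B' s2 erefl ssz sB'.
  by rewrite /= !mulmxA.
rewrite size_rcons in st; case: s2 => [|p2 s2] in ssz *.
  have od : odd (size s1) by move: os; rewrite -ssz cats1 !size_rcons /= negbK.
  have wE x y : fr *m word_mx true (rcons s1 x ++ [:: y]) *m fr =
      fr *m word_mx true s1 *m (speval false x *m speval true y *m fr).
    by rewrite cat_rcons word_mx_cat od /= mulmx1 !mulmxA.
  have [B' [c [sB' _ E]]] := edge_split p1 sq.
  rewrite wE E mulmxDr; apply: cornerD; last first.
    rewrite -scalemxAr; apply: cornerZ; rewrite !mulmxA; apply: corner_mulr.
    by apply: short => //; rewrite -ssz cats1 !size_rcons.
  rewrite -wE cat_rcons; case: m => [|m] in IHm sB' {sq E IHt} *.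
    move: sB'; rewrite leqn0 size_poly_eq0 => /eqP ->.
    by rewrite word_mx_cat od /= speval0 mul0mx !mulmx0 mul0mx; apply: corner0.
  apply: (IHm m (ltnSn m) (size s1)) => //.
  by rewrite -ssz !size_cat size_rcons /= addnS.
pose b := ~~ odd (size s1).
have wE x z : fr *m word_mx true (rcons s1 x ++ q :: z :: s2) *m fr =
    fr *m word_mx true s1 *m (speval b x *m speval (~~ b) q *m speval b z) *m
      (word_mx (~~ b) s2 *m fr).
  by rewrite cat_rcons word_mx_cat /= -/b negbK !mulmxA.
rewrite wE; pose S M := corner_span (fr *m word_mx true s1 *m M *m (word_mx (~~ b) s2 *m fr)).
apply: (@band_span S _ _ _ b q m sq); rewrite /S.
- by rewrite mulmx0 mul0mx; apply: corner0.
- by move=> M M' SM SM'; rewrite mulmxDr mulmxDl; apply: cornerD.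
- by move=> a M SM; rewrite -scalemxAr -scalemxAl; apply: cornerZ.
have sz x z : size (rcons s1 x ++ q :: z :: s2) = size s.
  by rewrite -ssz !size_cat !size_rcons.
move=> x z [sx|sz']; rewrite -wE.
  rewrite cat_rcons; apply: (IHt (size s1)) => //; first by rewrite -st.
  by rewrite -cat_rcons sz.
case: m => [|m] in IHm sz' {sq IHt} *.
  move: sz'; rewrite leqn0 size_poly_eq0 => /eqP ->.
  by rewrite wE speval0 !mulmx0 mul0mx; apply: corner0.
rewrite -[q :: _]cat1s catA; apply: (IHm m (ltnSn m) (size (rcons s1 x ++ [:: q]))) => //.
by rewrite -catA /= sz.
Qed.

(* For u of degree at most m vanishing at the first m nodes, the antisymmetric
   matrix M is supported on the band |i - k| <= m and its rows are orthogonal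
   to all polynomials of degree less than m, which forces its rows to vanish
   one after the other. *)
Lemma corner_sym_aux m (u : {poly F}) : (size u <= m.+1)%N ->
  (forall j : 'I_D.+1, (r <= j < r + m)%N -> u.[th false j] = 0) ->
  forall p q,
    fr *m speval true p *m speval false u *m speval true q *m fr =
    fr *m speval true q *m speval false u *m speval true p *m fr.
Proof.
move=> su u0.
pose G i k := fr *m (g true i *m speval false u *m g true k) *m fr.
have GE p q : fr *m speval true p *m speval false u *m speval true q *m fr =
    \sum_i \sum_k (p.[th true i] * q.[th true k]) *: G i k.
  transitivity (fr *m (speval true p *m speval false u *m speval true q) *m fr).
    by rewrite !mulmxA.
  rewrite speval_mul_sum mulmx_sumr mulmx_suml.
  apply: eq_bigr => i _; rewrite mulmx_sumr mulmx_suml; apply: eq_bigr => k _.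
  by rewrite -scalemxAr -scalemxAl.
suff symG : forall i k, G i k = G k i.
  move=> p q; rewrite !GE exchange_big /=.
  by apply: eq_bigr => i _; apply: eq_bigr => k _; rewrite mulrC symG.
have kill (p : {poly F}) : (size p <= m)%N ->
    speval false u *m speval true p *m fr = 0 /\
    fr *m speval true p *m speval false u = 0.
  (* Nodes below [r] vanish by [g_bottom] and the next [m] ones since [u] does; at the others the
     band rule applies to [p]. *)
  have node (j : 'I_D.+1) : (r + m <= j)%N \/ u.[th false j] *: g false j = 0.
    have [jr|rj] := ltnP j r; first by right; rewrite g_bottom ?scaler0.
    by have [jm|] := ltnP j (r + m); [right; rewrite u0 ?scale0r ?rj | left].
  move=> sp; split; rewrite [speval false u]/speval.
    rewrite !mulmx_suml; apply: big1 => j _; case: (node j) => [mj|->].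
      by rewrite -!scalemxAl (@g_band false) ?scaler0 //; apply/orP; right; lia.
    by rewrite !mul0mx.
  rewrite mulmx_sumr; apply: big1 => j _; case: (node j) => [mj|->].
    by rewrite -scalemxAr (@g_band false) ?scaler0 //; apply/orP; left; lia.
  by rewrite mulmx0.
have rowG a (p : {poly F}) : (size p <= m)%N ->
    \sum_k p.[th true k] *: (G a k - G k a) = 0.
  move=> sp; have [k1 k2] := kill p sp.
  transitivity (fr *m g true a *m (speval false u *m speval true p *m fr) -
     (fr *m speval true p *m speval false u) *m g true a *m fr); last first.
    by rewrite k1 k2 mulmx0 !mul0mx subrr.
  rewrite !mulmxA !(speval_mulr _ true p) !mulmx_suml -sumrB; apply: eq_bigr => k _.
  by rewrite scalerBr /G -!scalemxAl !mulmxA.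
suff symN : forall N (i k : 'I_D.+1), i = N :> nat -> G i k = G k i
  by move=> i k; apply: (symN i).
elim/ltn_ind=> N IH i k iN.
have [ltkN|leNk] := ltnP k N; first by apply/esym/(IH k).
have [->//|ki] := eqVneq k i.
have [lem|gtm] := leqP k (N + m); last first.
  rewrite /G !(@g_band true) ?mulmx0 ?mul0mx //; apply/orP; [right|left]; lia.
(* In row [N], columns before [N] are symmetric by induction, the diagonal trivially, and columns
   beyond [N + m] vanish; a polynomial of degree less than [m] isolates one of the other [m]
   columns. *)
pose s := [seq j : 'I_D.+1 <- enum 'I_D.+1 | N.+1 <= j < N.+1 + m]%N.
have [p sp hp] := interpolation true s (fun j => (j == k)%:R).
have Nk : (N < k)%N by move: ki; rewrite -val_eqE /=; lia.
have /eqP := rowG i p (leq_trans sp (size_filter_ord _ _)).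
rewrite (bigD1 k) //= hp ?eqxx ?scale1r; last by rewrite mem_filter mem_enum andbT; lia.
rewrite big1 ?addr0 ?subr_eq0 => [/eqP //|j jk].
have [ltj|lej] := ltnP j N; first by rewrite -(IH j ltj j) ?subrr ?scaler0.
have [->|ji] := eqVneq j i; first by rewrite subrr scaler0.
have [js|js] := ltnP j (N.+1 + m).
  rewrite hp ?(negPf jk) ?scale0r // mem_filter mem_enum andbT.
  by move: ji; rewrite -val_eqE /=; lia.
rewrite /G !(@g_band true) ?mulmx0 ?mul0mx ?subrr ?scaler0 //.
  by apply/orP; right; lia.
by apply/orP; left; lia.
Qed.

(** The middle [fr] is a polynomial in [A^*]; the identity is shown for every such polynomial [t],
    by induction on a degree bound. The interpolant of [t] at [r, ..., r + m - 1] has a smaller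
    bound, and the difference falls under [corner_sym_aux]. *)
Lemma corner_sym p q :
  fr *m speval true p *m fr *m speval true q *m fr =
  fr *m speval true q *m fr *m speval true p *m fr.
Proof.
suff sym m (t : {poly F}) : (size t <= m)%N ->
    fr *m speval true p *m speval false t *m speval true q *m fr =
    fr *m speval true q *m speval false t *m speval true p *m fr.
  by have [t tE] := speval_delta false r; have := sym _ t (leqnn _); rewrite -tE.
elim: m t => [|m IH] t.
  by rewrite leqn0 size_poly_eq0 => /eqP ->; rewrite speval0 !mulmx0 !mul0mx.
move=> st; pose s := [seq j : 'I_D.+1 <- enum 'I_D.+1 | r <= j < r + m]%N.
have [t' st' ht'] := interpolation false s (fun j => t.[th false j]).
have {}st' := leq_trans st' (size_filter_ord _ _).
have -> : t = t' + (t - t') by rewrite addrC subrK.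
rewrite spevalD !mulmxDr !mulmxDl IH //; congr (_ + _); apply: (@corner_sym_aux m).
  by rewrite (leq_trans (size_polyD _ _)) // size_polyN geq_max st (leq_trans st').
move=> j jr; rewrite hornerD hornerN ht' ?subrr // mem_filter mem_enum andbT; lia.
Qed.

(** Generators commute by [corner_sym]; in the product case the leading [fr] of [N], from
    [corner_head], provides the right end of a generator. *)
Lemma corner_comm p M : corner_span M ->
  fr *m speval true p *m M = M *m speval true p *m fr.
Proof.
have corner_head N : corner_span N -> exists N', N = fr *m N'.
  elim=> [q|q N0 _ _||N1 N2 _ [N1' ->] _ [N2' ->]|a N0 _ [N' ->]].
  - by exists (speval true q *m fr); rewrite mulmxA.
  - by exists (speval true q *m N0); rewrite mulmxA.
  - by exists 0; rewrite mulmx0.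
  - by exists (N1' + N2'); rewrite mulmxDr.
  by exists (a *: N'); rewrite -scalemxAr.
elim=> [q|q N cN IH||N N' _ IH _ IH'|a N _ IH].
- by rewrite !mulmxA corner_sym.
- have [N' NE] := corner_head _ cN.
  by rewrite -[RHS]mulmxA -[RHS]mulmxA [N *m _]mulmxA -IH NE !mulmxA corner_sym.
- by rewrite !mulmx0 !mul0mx.
- by rewrite mulmxDr !mulmxDl IH IH'.
by rewrite -scalemxAr -!scalemxAl IH.
Qed.

End Words.

(** * Submodules, cyclic vectors and annihilating products *)

Section Modules.
Variables (F : fieldType) (n : nat).

(** A space inside [G] grows by one outside vector at a time; dimension [n + 1] being impossible, it
    exhausts [G]. *)
Lemma vspace_of_closed (G : 'cV[F]_n -> Prop) :
  G 0 -> (forall u v, G u -> G v -> G (u + v)) ->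
  (forall a v, G v -> G (a *: v)) ->
  exists V : {vspace 'cV[F]_n}, forall v, v \in V <-> G v.
Proof.
move=> G0 GD GZ.
have ext k : exists2 V : {vspace 'cV[F]_n}, forall v, v \in V -> G v &
    (k <= \dim V)%N \/ forall v, G v -> v \in V.
  elim: k => [|k [V VG [kV|GV]]]; last by exists V => //; right.
    by exists 0%VS; [move=> v; rewrite memv0 => /eqP -> | left].
  have [GV|nGV] := EM (forall v, G v -> v \in V); first by exists V => //; right.
  have [v [Gv vV]] : exists v, G v /\ v \notin V.
    apply: contrapT => nex; apply: nGV => v Gv; apply: contrapT => nvV.
    by apply: nex; exists v; split=> //; apply/negP.
  exists (V + <[v]>)%VS => [_ /memv_addP[v1 /VG ? [_ /vlineP[a ->] ->]]|].
    by apply: GD => //; apply: GZ.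
  left; apply: leq_ltn_trans kV _; rewrite (ltn_leqif (dimv_leqif_sup (addvSl _ _))).
  apply: contra vV => /subvP; apply; rewrite memvE; exact: addvSr.
have [V VG [|GV]] := ext n.+1; last by exists V => v; split=> [/VG|/GV].
by move=> /leq_trans/(_ (dimvS (subvf V))); rewrite dimvf /dim /= muln1 ltnn.
Qed.

(** The orbit of [u] under the algebra is a nonzero submodule of [W]. *)
Lemma irreducible_cyclic (G : 'M[F]_n -> Prop) (W : {vspace 'cV[F]_n}) u v :
  irreducible_module (generated_subalgebra G) W -> u \in W -> u != 0 ->
  v \in W -> exists2 B, generated_subalgebra G B & v = B *m u.
Proof.
move=> [WT _ Wirr] uW u0 vW.
have [|||V VP] := @vspace_of_closed
    (fun v => exists2 B, generated_subalgebra G B & v = B *m u).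
- exists (0 *: 1%:M); first by apply: gen_scale; apply: gen_one.
  by rewrite scale0r mul0mx.
- move=> _ _ [B TB ->] [C TC ->]; exists (B + C); first exact: gen_add.
  by rewrite mulmxDl.
- move=> a _ [B TB ->]; exists (a *: B); first exact: gen_scale.
  by rewrite scalemxAl.
apply/VP; have [||V0|->] := Wirr V => //.
- move=> B w TB /VP[C TC ->]; apply/VP; exists (B *m C); first exact: gen_mul.
  by rewrite mulmxA.
- by apply/subvP => w /VP[B TB ->]; apply: WT.
have : u \in V by apply/VP; exists 1%:M; [apply: gen_one | rewrite mul1mx].
by rewrite V0 memv0 (negPf u0).
Qed.

Lemma mulmx_colP m (A B : 'M[F]_(m, n)) :
  (forall v : 'cV_n, A *m v = B *m v) -> A = B.
Proof.
move=> AB; apply/matrixP => i j; have := AB (delta_mx j 0).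
by rewrite -!colE => /matrixP/(_ i 0); rewrite !mxE.
Qed.

(** Multiplication by [P] restricts operators to [W] at the same matrix size. *)
Lemma vspace_projection (W : {vspace 'cV[F]_n}) :
  exists P : 'M[F]_n, forall v, P *m v \in W /\ (v \in W -> P *m v = v).
Proof.
pose P := \matrix_(i, j) projv W (delta_mx j 0) i 0; exists P.
suff PE v : P *m v = projv W v.
  by move=> v; rewrite PE memv_proj; split=> // vW; rewrite projv_id.
rewrite [v in RHS]matrix_sum_delta; apply/colP => i.
rewrite mxE linear_sum summxE; apply: eq_bigr => j _.
by rewrite big_ord1 linearZ !mxE mulrC.
Qed.

Lemma diag_split (Q H : 'M[F]_n) (d : 'rV[F]_n) (s : seq F) : Q \in unitmx ->
  H = invmx Q *m diag_mx d *m Q -> (forall k, d 0 k \in s) ->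
  foldr (fun a M => (H - a%:M) *m M) 1%:M s = 0.
Proof.
move=> Qu HE ds.
have -> : foldr (fun a M => (H - a%:M) *m M) 1%:M s =
    invmx Q *m diag_mx (\row_k \prod_(a <- s) (d 0 k - a)) *m Q.
  elim: s {ds} => [|a s IH] /=.
    rewrite (_ : \row_k _ = const_mx 1) ?diag_const_mx ?mulmx1 ?mulVmx //.
    by apply/rowP => k; rewrite !mxE big_nil.
  have -> : H - a%:M = invmx Q *m diag_mx (\row_k (d 0 k - a)) *m Q.
    rewrite {1}HE (_ : \row_k _ = d - const_mx a).
      rewrite linearB /= diag_const_mx mulmxBr mulmxBl.
      by rewrite mul_mx_scalar -scalemxAl mulVmx // scalemx1.
    by apply/rowP => k; rewrite !mxE.
  rewrite IH !mulmxA mulmxK // -[_ *m diag_mx _ *m diag_mx _]mulmxA mulmx_diag.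
  by congr (_ *m diag_mx _ *m _); apply/rowP => k; rewrite !mxE big_cons.
rewrite (_ : \row_k _ = 0) ?linear0 ?mulmx0 ?mul0mx //.
apply/rowP => k; rewrite !mxE; apply/eqP; rewrite prodf_seq_eq0.
by apply/hasP; exists (d 0 k); rewrite ?ds //= subrr.
Qed.

End Modules.

(** * Real eigenvectors of symmetric matrices *)

Section SymmetricReal.
Variable R : realType.

(* The eigenvalues of H over R[i] are real, hence H is annihilated by a product
   of linear factors over R. *)
Lemma symmetric_split n (H : 'M[R]_n) : H^T = H ->
  exists2 s : seq R,
    {in s, forall a, exists2 v : 'cV_n, v != 0 & H *m v = a *: v} &
    forall s' : seq R, {subset s <= s'} ->
      foldr (fun a M => (H - a%:M) *m M) 1%:M s' = 0.
Proof.
move=> Hsym; pose f := real_complex R; pose Hc := map_mx f H.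
have Hreal : Hc \is a mxOver Num.real.
  by apply/mxOverP => i j; rewrite mxE complex_real.
have Hherm : Hc \is hermsymmx.
  apply: realsym_hermsym => //; apply/is_hermitianmxP.
  by rewrite expr0 scale1r; apply/matrixP => i j; rewrite !mxE -[in LHS]Hsym mxE.
have /orthomx_spectralP := hermitian_normalmx Hherm.
set Q := spectralmx Hc; set d := spectral_diag Hc => HcE.
have Qu : Q \in unitmx := spectral_unit _.
have dR k : d 0 k = f (complex.Re (d 0 k)).
  have /mxOverP/(_ 0 k) := hermitian_spectral_diag_real Hherm.
  by move/RRe_real.
exists [seq complex.Re (d 0 k) | k : 'I_n].
  move=> _ /imageP[k _ ->].
  have : eigenvalue H (complex.Re (d 0 k)).
    apply: etrans (esym (eigenvalue_map f H _)) _.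
    apply: (etrans (congr1 (eigenvalue Hc) (esym (dR k)))).
    apply/eigenvalueP; exists (row k Q).
      rewrite HcE -!row_mul !mulmxA mulmxV // mul1mx row_mul row_diag_mx.
      by rewrite -scalemxAl -rowE.
    apply/negP => /eqP rk; have /(congr1 (row k)) := mulmxV Qu.
    rewrite row_mul rk mul0mx => /rowP/(_ k); rewrite !mxE eqxx => /eqP.
    by rewrite eq_sym oner_eq0.
  (* [eigenvalueP] yields a row vector; the symmetry of [H] makes its transpose a column
     eigenvector. *)
  case/eigenvalueP => v vH v0; exists v^T; first by rewrite trmx_eq0.
  by rewrite -[H]trmxK Hsym -trmx_mul vH linearZ.
move=> s' ss'; apply: (@map_mx_inj _ _ f); rewrite map_mx0.
have fE : map_mx f (foldr (fun a M => (H - a%:M) *m M) 1%:M s') =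
    foldr (fun a M => (Hc - a%:M) *m M) 1%:M (map f s').
  elim: s' {ss'} => [|a s' IH] /=; first by rewrite map_mx1.
  by rewrite map_mxM IH map_mxB map_scalar_mx.
rewrite fE; apply: (diag_split Qu HcE) => k; rewrite dR.
by apply/map_f/ss'/imageP; exists k.
Qed.

(** When the factors of the annihilating product are applied to [v] one after another, the last
    nonzero vector is an eigenvector; it satisfies [Q] because every factor preserves [Q]. *)
Lemma symmetric_eigenvector n (H : 'M[R]_n) (Q : 'cV[R]_n -> Prop) v :
  H^T = H -> (forall a w, Q w -> Q (H *m w - a *: w)) -> Q v -> v != 0 ->
  exists a, exists2 u, Q u & u != 0 /\ H *m u = a *: u.
Proof.
move=> /symmetric_split[s _ /(_ s (fun _ => id))] sH QH Qv v0.
have : foldr (fun a M => (H - a%:M) *m M) 1%:M s *m v = 0 by rewrite sH mul0mx.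
elim: s {sH} => [|a s IH] /=; first by rewrite mul1mx => /eqP; rewrite (negPf v0).
set M := foldr _ _ _ in IH *; have [Mv0 _|Mv0] := eqVneq (M *m v) 0; first exact: IH.
rewrite -mulmxA mulmxBl mul_scalar_mx => /eqP; rewrite subr_eq0 => /eqP HM.
exists a, (M *m v) => //; move: @M {IH Mv0 HM} => /=.
elim: s => [|b s IH] /=; first by rewrite mul1mx.
by rewrite -mulmxA mulmxBl mul_scalar_mx; apply: QH.
Qed.

End SymmetricReal.

(** * Tridiagonal pairs: the lowest corner is a line *)

Section TridiagonalPair.
Variables (R : realType) (n D : nat).
Variables (th : bool -> 'I_D.+1 -> R) (E : bool -> 'I_D.+1 -> 'M[R]_n).
Hypothesis th_inj : forall b, injective (th b).
Hypothesis E_sum : forall b, \sum_i E b i = 1%:M.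
Hypothesis E_mul : forall b i j, E b i *m E b j = if i == j then E b i else 0.
Hypothesis E_sym : forall b i, (E b i)^T = E b i.
Hypothesis E_tri : forall b (j l : 'I_D.+1), (j.+1 < l)%N || (l.+1 < j)%N ->
  E b j *m speval th E (~~ b) 'X *m E b l = 0.

Lemma speval1 b : speval th E b 1 = 1%:M.
Proof.
by rewrite -(E_sum b); apply: eq_bigr => i _; rewrite hornerC scale1r.
Qed.

Lemma spevalM b p q : speval th E b (p * q) = speval th E b p *m speval th E b q.
Proof.
rewrite [in RHS]/speval mulmx_suml; apply: eq_bigr => i _.
rewrite mulmx_sumr (bigD1 i) //= -scalemxAl -scalemxAr E_mul eqxx hornerM scalerA.
rewrite big1 ?addr0 // => j ji.
by rewrite -scalemxAl -scalemxAr E_mul eq_sym (negPf ji) !scaler0.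
Qed.

Lemma mulmx_insert b (x y : 'M[R]_n) : x *m y = \sum_k x *m E b k *m (E b k *m y).
Proof.
rewrite -[x in LHS]mulmx1 -(E_sum b) mulmx_sumr mulmx_suml.
by apply: eq_bigr => k _; rewrite !mulmxA -[_ *m E b k *m E b k]mulmxA E_mul eqxx.
Qed.

(** One factor ['X] shifts the index by at most one, by [E_tri]; idempotents inserted between the
    factors bound the total shift by the degree. *)
Lemma E_band b (j l : 'I_D.+1) (p : {poly R}) :
  (size p + j <= l)%N || (size p + l <= j)%N ->
  E b j *m speval th E (~~ b) p *m E b l = 0.
Proof.
elim/poly_ind: p j l => [|p c IH] j l; first by rewrite speval0 mulmx0 mul0mx.
rewrite size_MXaddC; case: ifP => [/andP[/eqP -> /eqP ->] _|_ jl].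
  by rewrite mul0r add0r speval0 mulmx0 mul0mx.
rewrite spevalD -alg_polyC spevalZ speval1 spevalM mulmxDr mulmxDl -scalemxAr -scalemxAl.
have jl' : (j == l) = false by apply/eqP => jlE; move: jl; rewrite jlE; lia.
rewrite mulmx1 E_mul jl' scaler0 addr0.
rewrite (mulmx_insert b (speval _ _ _ p)) mulmx_sumr mulmx_suml.
rewrite big1 // => k _.
have [kl|kl] := boolP ((k.+1 < l) || (l.+1 < k))%N.
  by rewrite -!mulmxA [E b k *m (speval _ _ _ _ *m _)]mulmxA E_tri ?mulmx0.
by rewrite !mulmxA IH ?mul0mx //; lia.
Qed.

Variable W : {vspace 'cV[R]_n}.
Variable G : 'M[R]_n -> Prop.
Hypothesis G_lev : forall B, G B -> exists b p, B = speval th E b p.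
Hypothesis G_E : forall b i, generated_subalgebra G (E b i).
Hypothesis W_irr : irreducible_module (generated_subalgebra G) W.

Let T := generated_subalgebra G.

Lemma T_lev b p : T (speval th E b p).
Proof.
apply: (big_ind T) => [|B C|i _]; last by apply/gen_scale/G_E.
  by rewrite -(scale0r 1%:M); apply/gen_scale/gen_one.
exact: gen_add.
Qed.

Lemma T_stable B w : T B -> w \in W -> B *m w \in W.
Proof. by case: W_irr => WT _ _; apply: WT. Qed.

Theorem endpoint_dim1 : exists r u,
  [/\ u \in W, u != 0, E false r *m u = u &
      forall w, w \in W -> exists c, E false r *m w = c *: u].
Proof.
have [P PP] := vspace_projection W.
have PW w : P *m w \in W by case: (PP w).
have Pid w : w \in W -> P *m w = w by case: (PP w).
(* [Q k] says that the index [k] occurs in [W]; the least such index is [r]. *)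
pose Q k := `[< exists2 i : 'I_D.+1, i = k :> nat &
  exists2 w, w \in W & E false i *m w <> 0 >].
have exQ : exists k, Q k.
  case: W_irr => _ W0 _; apply: contrapT => nQ; apply: W0; apply/eqP.
  rewrite -subv0; apply/subvP => w wW; rewrite memv0 -[w]mul1mx -(E_sum false).
  rewrite mulmx_suml big1 // => i _; apply: contrapT => Ew.
  by apply: nQ; exists i; apply/asboolP; exists i => //; exists w.
case: (ex_minnP exQ) => k /asboolP[r <- [w0 w0W /eqP Ew0]] rmin {k exQ}.
have bot (j : 'I_D.+1) w : (j < r)%N -> w \in W -> E false j *m w = 0.
  move=> jr wW; apply: contrapT => Ew; move: jr; rewrite ltnNge rmin //.
  by apply/asboolP; exists j => //; exists w.
have PTP B : T B -> P *m (B *m P) = B *m P.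
  move=> TB; apply: mulmx_colP => v; rewrite -!mulmxA Pid //.
  exact: T_stable.
(* Composition with [P] turns identities that hold on [W], such as the vanishing below [r], into
   identities of matrices. *)
pose g b i := E b i *m P.
have levP b p : speval th g b p = speval th E b p *m P.
  by rewrite /speval mulmx_suml; apply: eq_bigr => i _; rewrite scalemxAl.
have band b (j l : 'I_D.+1) (p : {poly R}) :
    (size p + j <= l)%N || (size p + l <= j)%N ->
    g b j *m speval th g (~~ b) p *m g b l = 0.
  move=> /E_band jl; rewrite levP /g -!mulmxA (PTP (E b l)) //.
  have TEl : T (speval th E (~~ b) p *m E b l) by apply: gen_mul (T_lev _ _) (G_E _ _).
  by rewrite [speval _ _ _ _ *m _]mulmxA (PTP _ TEl) !mulmxA jl mul0mx.
have gbot (j : 'I_D.+1) : (j < r)%N -> g false j = 0.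
  by move=> jr; apply: mulmx_colP => v; rewrite mul0mx -mulmxA bot.
pose fr := g false r.
(* The span of [fr] times words, encoded as what lies in every linearly closed predicate containing
   these products. *)
pose Wd M := forall S : 'M[R]_n -> Prop, S 0 -> (forall M N, S M -> S N -> S (M + N)) ->
  (forall a M, S M -> S (a *: M)) -> (forall s, S (fr *m word_mx th g true s)) -> S M.
have g1 b : speval th g b 1 = P by rewrite levP speval1 mul1mx.
have PE b i : P *m g b i = g b i by rewrite PTP.
have Plev b p : P *m speval th g b p = speval th g b p.
  by rewrite levP PTP //; apply: T_lev.
have Wd_lev b p M : Wd M -> Wd (M *m speval th g b p).
  move=> WM S S0 SD SZ Sw; apply: (WM (fun N => S (N *m speval th g b p))).
  - by rewrite mul0mx.
  - by move=> N N' SN SN'; rewrite mulmxDl; apply: SD.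
  - by move=> a N SN; rewrite -scalemxAl; apply: SZ.
  move=> s; pose b' := ~~ odd (size s); have [<-|bb'] := eqVneq b' b.
    have := Sw (rcons s p); rewrite -cats1 word_mx_cat /= mulmx1 mulmxA; exact.
  (* To keep the word alternating, a letter [1] is inserted; it evaluates to [P] and is absorbed. *)
  have := Sw (s ++ [:: 1; p]); rewrite word_mx_cat /= mulmx1 g1.
  have -> : ~~ ~~ odd (size s) = b by move: bb'; rewrite /b'; case: (odd _) (b) => -[].
  by rewrite Plev mulmxA.
have Wd_T B : T B -> forall M, Wd M -> Wd (M *m (B *m P)).
  elim=> [{}B /G_lev[b [p ->]]||a {}B _ IH|{}B C _ IH _ IH'|{}B C TB IH TC IH'] M WM.
  - by rewrite -levP; apply: Wd_lev.
  - by rewrite -(speval1 true) -levP; apply: Wd_lev.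
  - by rewrite -scalemxAl -scalemxAr => S S0 SD SZ Sw; exact: SZ (IH M WM S S0 SD SZ Sw).
  - by rewrite mulmxDl mulmxDr => S S0 SD SZ Sw;
    exact: SD (IH M WM S S0 SD SZ Sw) (IH' M WM S S0 SD SZ Sw).
  have -> : M *m (B *m C *m P) = M *m (B *m P) *m (C *m P).
    by rewrite -!mulmxA PTP.
  exact: IH' _ (IH _ WM).
have corner B : T B -> corner_span th g r (fr *m (B *m P) *m fr).
  move=> TB; have : Wd (fr *m (B *m P)).
    by apply: Wd_T => // S _ _ _ /(_ [::]); rewrite /= mulmx1.
  move=> WB; apply: (WB (fun N => corner_span th g r (N *m fr))).
  - by rewrite mul0mx; apply: corner0.
  - by move=> N N' SN SN'; rewrite mulmxDl; apply: cornerD.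
  - by move=> a N SN; rewrite -scalemxAl; apply: cornerZ.
  move=> s; have [os|es] := boolP (odd (size s)).
    exact: (word_corner_span th_inj band gbot).
  rewrite (_ : _ *m fr = fr *m word_mx th g true (s ++ [:: 1]) *m fr).
    apply: (word_corner_span th_inj band gbot).
    by rewrite size_cat addn1 /= es.
  by rewrite word_mx_cat /= mulmx1 g1 -!mulmxA PE.
pose Er := E false r; have TEr : T Er by apply: G_E.
have ErEr : Er *m Er = Er by rewrite E_mul eqxx.
pose H p := Er *m speval th E true p *m Er.
have Hsym p : (H p)^T = H p.
  rewrite /H !trmx_mul E_sym mulmxA; congr (_ *m _ *m _).
  by rewrite /speval linear_sum; apply: eq_bigr => i _; rewrite linearZ /= E_sym.
pose u := Er *m w0.
have uW : u \in W by apply: T_stable.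
have u0 : u != 0 by [].
have uE : Er *m u = u by rewrite mulmxA ErEr.
(* [H p] has an eigenvector [z] in the corner of [W]. Any [v] there is [B z] with [B] in the
   algebra, and [H p] commutes with the compression of [B] to the corner, so [v] has the same
   eigenvalue. *)
have Hscal p : exists a, forall v, v \in W -> Er *m v = v -> H p *m v = a *: v.
  have Qclosed a w : w \in W /\ Er *m w = w ->
      H p *m w - a *: w \in W /\ Er *m (H p *m w - a *: w) = H p *m w - a *: w.
    have TH : T (H p) := (gen_mul (gen_mul TEr (T_lev _ _)) TEr).
    move=> [wW wE]; split; first by rewrite rpredB ?rpredZ //; exact: (T_stable TH wW).
    by rewrite mulmxBr -scalemxAr wE !mulmxA ErEr.
  have [a [z [zW zE] [z0 Hz]]] :=
    symmetric_eigenvector (Hsym p) Qclosed (conj uW uE) u0.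
  exists a => v vW vE.
  have [B TB vB] := irreducible_cyclic W_irr zW z0 vW.
  have := corner_comm th_inj band gbot p (corner B TB).
  move=> /(congr1 (mulmx^~ z)) /=; rewrite -/fr levP /fr /g -/Er -!mulmxA.
  rewrite !Pid //; do ?[apply: T_stable => //; try exact: T_lev].
  rewrite zE -vB vE => HB.
  have Hz' : Er *m (speval th E true p *m z) = a *: z by rewrite -Hz -!mulmxA zE.
  by rewrite HB Hz' -!scalemxAr -vB vE.
have corner_scal M : corner_span th g r M -> exists c, M *m u = c *: u.
  have base p : exists c, fr *m speval th g true p *m u = c *: u.
    have [a Ha] := Hscal p; exists a.
    rewrite -(Ha u uW uE) levP /fr /g -/Er -!mulmxA uE !Pid //.
    exact: T_stable (T_lev _ _) uW.
  have fru : fr *m u = u by rewrite -mulmxA Pid.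
  elim=> [p|p N _ [c Nc]||N N' _ [c Nc] _ [c' Nc']|b N _ [c Nc]].
  - by have [a Ha] := base p; exists a; rewrite -mulmxA fru.
  - by have [a Ha] := base p; exists (c * a); rewrite -mulmxA Nc -scalemxAr Ha scalerA.
  - by exists 0; rewrite mul0mx scale0r.
  - by exists (c + c'); rewrite mulmxDl Nc Nc' scalerDl.
  by exists (b * c); rewrite -scalemxAl Nc scalerA.
exists r, u; split=> // w wW; rewrite -/Er.
have [B TB ->] := irreducible_cyclic W_irr uW u0 wW.
have [c Bc] := corner_scal _ (corner B TB); exists c; rewrite -Bc.
by rewrite /fr /g -/Er -!mulmxA !Pid ?uE //; do ?apply: T_stable.
Qed.

End TridiagonalPair.

(** * Distance in a connected graph *)

Section Distance.
Variables (X : finType) (e : rel X).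
Hypothesis e_graph : simple_connected_graph e.

Let e_sym : symmetric e. Proof. by case: e_graph. Qed.
Let e_irr : irreflexive e. Proof. by case: e_graph. Qed.
Let e_conn y z : connect e y z. Proof. by case: e_graph. Qed.

Lemma walkP k y z : reflect
  (exists2 p : seq X, path e y p & size p = k /\ last y p = z) (walk e k y z).
Proof.
apply: (iffP existsP) => [[p /andP[pp /eqP pz]]|[p pp [sp pz]]].
  by exists p; rewrite ?size_tuple.
by move: (introT eqP sp) => sp'; exists (Tuple sp'); rewrite /= pp pz eqxx.
Qed.

Lemma walk0 y z : walk e 0 y z = (y == z).
Proof.
apply/walkP/eqP => [[p _ [/size0nil -> //]]|->]; by exists [::].
Qed.

Lemma walkS k y z : walk e k.+1 y z <-> exists2 w, e y w & walk e k w z.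
Proof.
split=> [/walkP[[|w p] pp [//= [sp] pz]]|[w yw /walkP[p wp [sp pz]]]].
  by case/andP: pp => yw wp; exists w => //; apply/walkP; exists p.
by apply/walkP; exists (w :: p); rewrite /= ?yw ?sp.
Qed.

Lemma walk_sym k y z : walk e k y z -> walk e k z y.
Proof.
elim: k y z => [|k IH] y z; first by rewrite !walk0 eq_sym.
move=> /walkS[w yw /IH/walkP[p pp [sp pz]]]; apply/walkP; exists (rcons p y).
  by rewrite rcons_path pp pz e_sym.
by rewrite size_rcons sp last_rcons.
Qed.

Lemma gdist_walk y z : walk e (gdist e y z) y z.
Proof. by case: (gdistP (e_conn y z)). Qed.

Lemma gdist_le y z k : walk e k y z -> (gdist e y z <= k)%N.
Proof. by case: (gdistP (e_conn y z)) => _; apply. Qed.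

Lemma gdistC y z : gdist e y z = gdist e z y.
Proof.
by apply/eqP; rewrite eqn_leq !gdist_le // walk_sym // gdist_walk.
Qed.

Lemma gdist_eq0 y z : (gdist e y z == 0)%N = (y == z).
Proof.
apply/eqP/eqP => [yz|->]; first by apply/eqP; rewrite -walk0 -yz gdist_walk.
by apply/eqP; rewrite -leqn0 gdist_le // walk0.
Qed.

Lemma gdist_step y w z : e y w -> (gdist e y z <= (gdist e w z).+1)%N.
Proof. by move=> yw; apply/gdist_le/walkS; exists w => //; apply: gdist_walk. Qed.

Lemma gdist_pred y z k : gdist e y z = k.+1 ->
  exists2 w, e y w & gdist e w z = k.
Proof.
move=> yz; have := gdist_walk y z; rewrite yz => /walkS[w yw wz].
exists w => //; apply/eqP; rewrite eqn_leq gdist_le //=.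
by have := gdist_step z yw; rewrite yz ltnS.
Qed.

Lemma gdist_eq1 y z : (gdist e y z == 1)%N = e y z.
Proof.
apply/eqP/idP => [/gdist_pred[w yw /eqP]|yz]; first by rewrite gdist_eq0 => /eqP <-.
apply/eqP; rewrite eqn_leq lt0n gdist_eq0; apply/andP; split.
  by apply/gdist_le/walkS; exists z => //; rewrite walk0.
by apply: contraTneq yz => ->; rewrite e_irr.
Qed.

Lemma gdist_le_diameter y z : (gdist e y z <= diameter e)%N.
Proof.
apply: leq_trans (leq_bigmax _ : _ <= \max_(y : X) _)%N.
exact: (leq_bigmax (F := fun z => gdist e y z)).
Qed.

Lemma gdist_onto (x : X) k : (k <= diameter e)%N -> exists y z, gdist e y z = k.
Proof.
have X0 : (0 < #|X|)%N by apply/card_gt0P; exists x.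
have [y yE] := bigop.eq_bigmax (fun y : X => \max_(z : X) gdist e y z)%N X0.
have [z zE] := bigop.eq_bigmax (fun z : X => gdist e y z) X0.
rewrite /diameter yE zE {yE zE} => kd.
have [m mE] : exists m, gdist e y z = (k + m)%N.
  by exists (gdist e y z - k)%N; rewrite subnKC.
elim: m y mE {kd} => [|m IH] y; first by rewrite addn0 => yz; exists y, z.
by rewrite addnS => /gdist_pred[w _ /IH].
Qed.

End Distance.

(** * Eigenvector decomposition from an annihilating product *)

Section EigenDecomposition.
Variables (F : fieldType) (n : nat) (A : 'M[F]_n).

Let prodA (s : seq F) := foldr (fun a M => (A - a%:M) *m M) 1%:M s.

(** The factors after the first send [v] to an eigenvector [u] for [a] and multiply [u] by [c],
    nonzero as the list has no repetition. So [c^-1 *: u] is the component for [a], and the rest is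
    killed by the shorter product. *)
Lemma eigen_decomposition (s : seq F) (v : 'cV[F]_n) :
  uniq s -> prodA s *m v = 0 ->
  exists f : F -> 'cV[F]_n,
    v = \sum_(a <- s) f a /\ {in s, forall a, A *m f a = a *: f a}.
Proof.
have prod_eigen t a (u : 'cV[F]_n) : A *m u = a *: u ->
    prodA t *m u = (\prod_(b <- t) (a - b)) *: u.
  move=> Au; elim: t => [|b t IH] /=; first by rewrite big_nil mul1mx scale1r.
  rewrite big_cons -mulmxA IH -scalemxAr mulmxBl mul_scalar_mx Au -scalerBl.
  by rewrite scalerA mulrC.
elim: s v => [|a s IH] v /=.
  by rewrite mul1mx => _ ->; exists (fun=> 0); rewrite big_nil.
move=> /andP[as_ us]; rewrite -/(prodA s) -mulmxA mulmxBl mul_scalar_mx.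
set u := prodA s *m v => /eqP; rewrite subr_eq0 => /eqP Au.
pose c := \prod_(b <- s) (a - b).
have c0 : c != 0.
  apply/negP; rewrite prodf_seq_eq0 => /hasP[b bs] /=; rewrite subr_eq0 => /eqP ab.
  by rewrite ab bs in as_.
have [|f [fE fA]] := IH (v - c^-1 *: u) us.
  by rewrite mulmxBr -scalemxAr (prod_eigen _ _ _ Au) scalerA mulVf // scale1r subrr.
exists (fun b => if b == a then c^-1 *: u else f b); split.
  rewrite big_cons eqxx -[LHS](subrK (c^-1 *: u)) addrC fE; congr (_ + _).
  rewrite !big_seq; apply: eq_bigr => b bs; case: eqP => // ba.
  by rewrite -ba bs in as_.
move=> b; rewrite inE; case: eqP => [-> _|_ /= /fA //].
by rewrite -scalemxAr Au !scalerA mulrC.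
Qed.

End EigenDecomposition.

(** * Primitive idempotents of a symmetric matrix *)

Section Projections.
Variables (R : realType) (n D : nat) (A : 'M[R]_n) (theta : 'I_D.+1 -> R).
Variables (V : 'I_D.+1 -> {vspace 'cV[R]_n}) (E : 'I_D.+1 -> 'M[R]_n).
Hypothesis A_sym : A^T = A.
Hypothesis theta_inj : injective theta.
Hypothesis V_eigen : forall i v, v \in V i <-> A *m v = theta i *: v.
Hypothesis A_eigen : forall a (v : 'cV[R]_n), v != 0 -> A *m v = a *: v ->
  exists i, a = theta i.
Hypothesis E_proj : forall i, orthogonal_projection (V i) (E i).

Lemma V_orthogonal i j u v : i != j -> u \in V i -> v \in V j -> u^T *m v = 0.
Proof.
move=> ij /V_eigen Au /V_eigen Av.
have : theta i *: (u^T *m v) = theta j *: (u^T *m v).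
  rewrite scalemxAl -linearZ /= -Au trmx_mul A_sym -mulmxA Av.
  by rewrite scalemxAr.
move/eqP; rewrite -subr_eq0 -scalerBl scaler_eq0 subr_eq0.
by rewrite (inj_eq theta_inj) (negPf ij) => /eqP.
Qed.

(** The product of [symmetric_split] may run over all [theta i], since its roots are eigenvalues. *)
Lemma V_decomposition (v : 'cV[R]_n) :
  exists2 f, v = \sum_i f i & forall i, f i \in V i.
Proof.
have [s sA ss'] := symmetric_split A_sym.
have s0 : foldr (fun a M => (A - a%:M) *m M) 1%:M (map theta (enum 'I_D.+1)) = 0.
  apply: ss' => a /sA[u u0 /(A_eigen u0)[i ->]].
  by rewrite map_f // mem_enum.
have [||f [fE fA]] := @eigen_decomposition _ _ A (map theta (enum 'I_D.+1)) v.
- by rewrite map_inj_uniq // enum_uniq.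
- by rewrite s0 mul0mx.
exists (f \o theta) => [|i]; first by rewrite fE big_map big_enum.
by apply/V_eigen/fA; rewrite map_f // mem_enum.
Qed.

Lemma E_decomposition (f : 'I_D.+1 -> 'cV[R]_n) i : (forall i, f i \in V i) ->
  E i *m \sum_j f j = f i.
Proof.
move=> fV; have [Eid E0] := E_proj i.
rewrite mulmx_sumr (bigD1 i) //= Eid // big1 ?addr0 // => j ji.
apply: E0 => u uV; apply: (@V_orthogonal i j) => //; by rewrite eq_sym.
Qed.

Lemma E_range i v : E i *m v \in V i.
Proof. by have [f -> fV] := V_decomposition v; rewrite E_decomposition. Qed.

Lemma primitive_sum : \sum_i E i = 1%:M.
Proof.
apply: mulmx_colP => v; rewrite mul1mx mulmx_suml.
have [f vE fV] := V_decomposition v; rewrite [in RHS]vE.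
by apply: eq_bigr => i _; rewrite vE E_decomposition.
Qed.

Lemma primitive_mul i j : E i *m E j = if i == j then E i else 0.
Proof.
apply: mulmx_colP => v; rewrite -mulmxA.
have [Eid E0] := E_proj i; case: eqP => [->|/eqP ij].
  have [Ejid _] := E_proj j; exact/Ejid/E_range.
rewrite mul0mx; apply: E0 => u uV; apply: (V_orthogonal ij uV); exact: E_range.
Qed.

Lemma primitive_spectral : \sum_i theta i *: E i = A.
Proof.
apply: mulmx_colP => v; rewrite mulmx_suml -[v in RHS]mul1mx -primitive_sum.
rewrite mulmx_suml mulmx_sumr; apply: eq_bigr => i _.
by rewrite -scalemxAl; apply/esym/V_eigen/E_range.
Qed.

(** By orthogonality of the eigenspaces, the transposed resolution of the identity times [E i]
    reduces to [(E i)^T *m E i], which is symmetric. *)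
Lemma primitive_sym i : (E i)^T = E i.
Proof.
have E_orth j k : j != k -> (E j)^T *m E k = 0.
  move=> jk; apply: mulmx_colP => v; apply/trmx_inj; apply: mulmx_colP => w.
  rewrite mul0mx trmx0 mul0mx -mulmxA trmx_mul trmxK -mulmxA.
  rewrite trmx_mul -mulmxA mulmxA -trmx_mul.
  by apply: (@V_orthogonal k j); rewrite ?E_range // eq_sym.
have EE : E i = (E i)^T *m E i.
  rewrite -[E i in LHS]mul1mx -trmx1 -primitive_sum linear_sum /= mulmx_suml.
  by rewrite (bigD1 i) //= big1 ?addr0 // => j ji; apply: E_orth.
by rewrite EE trmx_mul trmxK.
Qed.

Lemma primitive_neq0 i : (exists2 v, v \in V i & v != 0) -> E i != 0.
Proof.
move=> [v vV v0]; apply: contra v0 => /eqP Ei0; have [Eid _] := E_proj i.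
by rewrite -(Eid v vV) Ei0 mul0mx.
Qed.

End Projections.

(** * The Bose-Mesner algebra of a distance-regular graph *)

Section BoseMesner.
Variables (R : realType) (X : finType) (e : rel X) (D : nat).
Variables (theta : 'I_D.+1 -> R) (E : 'I_D.+1 -> 'M[R]_#|X|).
Hypothesis e_drg : distance_regular e.
Hypothesis e_diam : diameter e = D.
Hypothesis D_gt0 : (0 < D)%N.
Hypothesis theta_inj : injective theta.
Hypothesis E_sum : \sum_i E i = 1%:M.
Hypothesis E_mul : forall i j, E i *m E j = if i == j then E i else 0.
Hypothesis E_sym : forall i, (E i)^T = E i.
Hypothesis E_spectral : \sum_i theta i *: E i = adjacency R e.
Hypothesis E_neq0 : forall i, E i != 0.

Let A := adjacency R e.
Let d (k l : 'I_#|X|) := gdist e (enum_val k) (enum_val l).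
Let e_graph : simple_connected_graph e. Proof. by case: e_drg. Qed.

Lemma vdist_lt k l : (d k l < D.+1)%N.
Proof. by rewrite ltnS -e_diam gdist_le_diameter. Qed.

Lemma vdist_eq0 k l : (d k l == 0)%N = (k == l).
Proof. by rewrite gdist_eq0 // (inj_eq enum_val_inj). Qed.

Lemma vdist_refl k : d k k = 0%N.
Proof. by apply/eqP; rewrite vdist_eq0. Qed.

Lemma vdist_onto j : (j <= D)%N -> (0 < #|X|)%N -> exists k l, d k l = j.
Proof.
move=> jD /card_gt0P[x _]; have [||y [z yz]] := @gdist_onto _ e _ x j => //.
  by rewrite e_diam.
by exists (enum_rank y), (enum_rank z); rewrite /d !enum_rankK.
Qed.

(** The Bose-Mesner algebra, as the span of the distance matrices. *)
Definition bose_mesner (M : 'M[R]_#|X|) :=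
  exists c : nat -> R, forall k l, M k l = c (d k l).

Lemma sum_enum_val (f : X -> R) : \sum_(k < #|X|) f (enum_val k) = \sum_y f y.
Proof. by rewrite -(big_enum_val (A := predT)). Qed.

(** An entry of the product sums over the neighbours of [y]; [p h 1 j] of them are at distance [j]
    from [z]. *)
Lemma bose_mesner_adj M : bose_mesner M -> bose_mesner (A *m M).
Proof.
move=> [c Mc]; have [_ [p pP]] := e_drg.
exists (fun h => \sum_(j < D.+1) c j *+ p h 1%N j) => k l.
set y := enum_val k; set z := enum_val l.
transitivity (\sum_w if e y w then c (gdist e z w) else 0).
  rewrite -sum_enum_val mxE; apply: eq_bigr => m _.
  rewrite !mxE Mc /d (gdistC e_graph _ (enum_val l)) -/y -/z.
  by case: ifP => _; rewrite ?mul1r ?mul0r.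
rewrite -big_mkcond (partition_big (fun w => inord (gdist e z w) : 'I_D.+1) xpredT) //=.
apply: eq_bigr => j _.
have dz w : (inord (gdist e z w) == j :> 'I_D.+1) = (gdist e z w == j)%N.
  by rewrite -val_eqE /= inordK // ltnS -e_diam gdist_le_diameter.
rewrite (eq_bigr (fun=> c j)) => [|w /andP[_]]; last by rewrite dz => /eqP ->.
have := pP (d k l) 1%N j; rewrite e_diam.
move=> /(_ (vdist_lt k l) D_gt0 (ltn_ord j) y z erefl) <-.
rewrite sumr_const; congr (_ *+ _); apply: eq_card => w.
by rewrite !inE unfold_in /= dz gdist_eq1.
Qed.

(** Polynomials in [A] alone: both families of [speval] are those of [A], and the Boolean is a
    dummy. *)
Let pol p := speval (fun=> theta) (fun=> E) true p.

Lemma pol1 : pol 1 = 1%:M.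
Proof. exact: (@speval1 _ _ _ (fun=> theta) (fun=> E) (fun=> E_sum)). Qed.

Lemma polM p q : pol (p * q) = pol p *m pol q.
Proof. exact: (@spevalM _ _ _ (fun=> theta) (fun=> E) (fun=> E_mul)). Qed.

Lemma polX : pol 'X = A.
Proof. by rewrite -[RHS]E_spectral; apply: eq_bigr => i _; rewrite hornerX. Qed.

Lemma pol_idempotent i : exists p, E i = pol p.
Proof. exact: (@speval_delta _ _ _ (fun=> theta) (fun=> E) (fun=> theta_inj) true i). Qed.

Lemma bose_mesner_pol p : bose_mesner (pol p).
Proof.
elim/poly_ind: p => [|p a IH].
  by exists (fun=> 0) => k l; rewrite /pol speval0 mxE.
rewrite mulrC /pol spevalD -/(pol _) polM polX -alg_polyC spevalZ -/(pol 1) pol1.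
have [c Ac] := bose_mesner_adj IH.
exists (fun h => c h + a * (h == 0%N)%:R) => k l.
by rewrite mxE Ac !mxE vdist_eq0.
Qed.

Lemma E_bose_mesner i : bose_mesner (E i).
Proof. by have [p ->] := pol_idempotent i; apply: bose_mesner_pol. Qed.

Lemma E_entries : exists c : 'I_D.+1 -> nat -> R, forall i k l, E i k l = c i (d k l).
Proof.
have [c cE] := fin_all_exists E_bose_mesner.
by exists c.
Qed.

(** The entries of the [t]-th power of [A] count walks of length [t]. *)
Lemma pol_exp_entries t k l : [/\ 0 <= pol 'X^t k l,
  (t < d k l)%N -> pol 'X^t k l = 0 & d k l = t -> 0 < pol 'X^t k l].
Proof.
elim: t k l => [|t IH] k l.
  rewrite expr0 pol1 mxE -vdist_eq0; case: (d k l) => [|m] //=.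
rewrite exprS polM polX mxE.
have term m : 0 <= A k m * pol 'X^t m l.
  by apply: mulr_ge0; [rewrite mxE ler0n | case: (IH m l)].
split=> [|tl|ktl]; first exact: sumr_ge0.
  apply: big1 => m _; rewrite mxE; case: (boolP (e _ _)) => km; last by rewrite mul0r.
  have [_ -> //] := IH m l; first by rewrite mulr0.
  have := gdist_step e_graph (enum_val l) km; rewrite -/(d k l) -/(d m l) => kl.
  by rewrite -ltnS (leq_trans tl).
have [w kw wl] := gdist_pred e_graph ktl.
rewrite (bigD1 (enum_rank w)) //= ltr_pwDl ?sumr_ge0 //.
have [_ _ H] := IH (enum_rank w) l; rewrite mxE enum_rankK kw mul1r; apply: H.
by rewrite /d enum_rankK.
Qed.

(* A suitable power of A vanishes at the larger of two distances and not at the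
   smaller one. *)
Lemma E_separate k l k' l' : (forall i, E i k l = E i k' l') -> d k l = d k' l'.
Proof.
wlog lt_dd : k l k' l' / (d k l < d k' l')%N => [H EE|EE].
  case: (ltngtP (d k l) (d k' l')) => // lt; first exact: H.
  by apply/esym/H.
have [_ _ /(_ erefl)] := pol_exp_entries (d k l) k l.
have [_ /(_ lt_dd) p0 _] := pol_exp_entries (d k l) k' l'.
suff -> : pol 'X^(d k l) k l = pol 'X^(d k l) k' l' by rewrite p0 ltxx.
by rewrite /pol /speval !summxE; apply: eq_bigr => i _; rewrite !mxE EE.
Qed.

(** * Krein parameters and dual eigenvalues *)

Section Krein.
Variable q : 'I_D.+1 -> 'I_D.+1 -> 'I_D.+1 -> R.
Hypothesis q_krein : krein_parameters E q.
Hypothesis q_poly : forall h i j : 'I_D.+1,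
  ([|| i + j < h, h + j < i | h + i < j]%N -> q h i j = 0) /\
  ([|| h == i + j :> nat, i == h + j :> nat | j == h + i :> nat]%N ->
   q h i j <> 0).

Lemma krein_entries i j k l :
  E i k l * E j k l = #|X|%:R^-1 * \sum_h q h i j * E h k l.
Proof.
have /matrixP/(_ k l) := q_krein i j; rewrite !mxE => ->; congr (_ * _).
by rewrite summxE; apply: eq_bigr => h _; rewrite mxE.
Qed.

Lemma E_diag i k : E i k k = \sum_l E i k l ^+ 2.
Proof.
have /matrixP/(_ k k) := E_mul i i; rewrite eqxx mxE => <-.
by apply: eq_bigr => l _; rewrite -[in E i l k]E_sym mxE expr2.
Qed.

(** A diagonal entry is the sum of the squares in its row and the diagonal is constant, so a zero on
    it makes [E i] vanish. *)
Lemma E_diag_neq0 i k : E i k k != 0.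
Proof.
have [c cE] := E_entries; apply: contra (E_neq0 i) => /eqP Ekk.
apply/eqP/matrixP => m l; rewrite mxE; apply/eqP; rewrite -sqrf_eq0.
have : \sum_l E i m l ^+ 2 = 0 by rewrite -E_diag -Ekk !cE !vdist_refl.
by move=> /psumr_eq0P -> // l' _; apply: sqr_ge0.
Qed.

(* Since E_0 o E_j is a multiple of E_j, all entries of E_0 at positions of
   nonzero entries of A coincide with the diagonal ones; then the rows of E_0
   indexed by adjacent vertices are equal. *)
Lemma E0_const k l : E ord0 k l = E ord0 k k.
Proof.
have [c cE] := E_entries.
have E0j j k' l' : E ord0 k' l' * E j k' l' = #|X|%:R^-1 * q j ord0 j * E j k' l'.
  rewrite krein_entries (bigD1 j) //= big1 ?addr0 ?mulrA // => h hj.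
  have [-> ] := q_poly h ord0 j; first by rewrite mul0r.
  by move: hj; rewrite -val_eqE /= !add0n addn0 neq_ltn orbC.
have E0diag j k' l' : E ord0 k' l' * E j k' l' = E ord0 k k * E j k' l'.
  rewrite E0j; congr (_ * _); apply: (mulIf (E_diag_neq0 j k)).
  by rewrite -E0j.
have E0adj k' l' : e (enum_val k') (enum_val l') -> E ord0 k' l' = E ord0 k k.
  move=> kl; have : E ord0 k' l' * A k' l' = E ord0 k k * A k' l'.
    rewrite /A -E_spectral summxE !mulr_sumr; apply: eq_bigr => j _.
    by rewrite mxE mulrCA E0diag mulrCA.
  by rewrite mxE kl !mulr1.
have E0row k' l' m : e (enum_val k') (enum_val l') -> E ord0 k' m = E ord0 l' m.
  move=> kl; have dot a b : \sum_m E ord0 a m * E ord0 b m = E ord0 a b.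
    have /matrixP/(_ a b) := E_mul ord0 ord0; rewrite mxE => <-.
    by apply: eq_bigr => l0 _; rewrite -[in E ord0 l0 b]E_sym mxE.
  have : \sum_m (E ord0 k' m - E ord0 l' m) ^+ 2 = 0.
    transitivity (E ord0 k' k' - E ord0 k' l' *+ 2 + E ord0 l' l').
      rewrite -!dot -sumrMnl -sumrB -big_split /=; apply: eq_bigr => m' _.
      by rewrite sqrrB !expr2.
    by rewrite (E0adj _ _ kl) !cE !vdist_refl; ring.
  move=> /psumr_eq0P H; apply/eqP; rewrite -subr_eq0 -sqrf_eq0 H //.
  by move=> m' _; apply: sqr_ge0.
move: {2}(d k l) (erefl (d k l)) => t; elim: t k l {E0diag E0adj} => [|t IH] k l kl.
  by move/eqP: kl; rewrite vdist_eq0 => /eqP ->.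
have [w kw wl] := gdist_pred e_graph kl.
rewrite (E0row k (enum_rank w)) ?enum_rankK // IH /d ?enum_rankK //.
by rewrite !cE !vdist_refl.
Qed.

(** The entrywise product of [E i1] and [E i] involves only [E h] with [h <= i + 1], with nonzero
    coefficient at [h = i + 1]; solving for that term gives the recursion. *)
Lemma E_polynomial (i1 : 'I_D.+1) : i1 = 1%N :> nat -> forall i : 'I_D.+1,
  exists p : {poly R}, forall k l, E i k l = p.[E i1 k l].
Proof.
move=> i11 i; case: i => i iD; have [m] := ubnP i.
elim: m i iD => // m IH [|i] iD; rewrite ltnS => im.
  have [c cE] := E_entries.
  exists (c ord0 0%N)%:P => k l; rewrite hornerC (_ : Ordinal iD = ord0).
    by rewrite E0_const cE vdist_refl.
  exact: val_inj.
have iD' : (i < D.+1)%N by apply: ltnW.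
pose j := Ordinal iD'; pose j1 := Ordinal iD.
have qj1 : q j1 i1 j != 0.
  by apply/eqP; have [_] := q_poly j1 i1 j; apply; rewrite /= i11 add1n eqxx.
have X0 : #|X|%:R != 0 :> R.
  rewrite pnatr_eq0 -lt0n; case: (posnP #|X|) => // X0.
  case/negP: (E_neq0 ord0); apply/eqP/matrixP => k.
  by exfalso; have := ltn_ord k; rewrite [X in (_ < X)%N]X0.
have below h : exists p : {poly R}, (h <= i)%N -> forall k l (hD : (h < D.+1)%N),
    E (Ordinal hD) k l = p.[E i1 k l].
  have [hi|hi] := leqP h i; last by exists 0.
  have hD : (h < D.+1)%N by apply: leq_ltn_trans hi iD'.
  have [p pE] := IH h hD (leq_ltn_trans hi im).
  by exists p => _ k l hD'; rewrite -pE; congr (E _ k l); apply: val_inj.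
have [p pE] := choice below.
exists ((q j1 i1 j)^-1 *: (#|X|%:R *: ('X * p i) -
  \sum_(h < D.+1 | (h <= i)%N) q h i1 j *: p h)) => k l.
rewrite hornerZ hornerD hornerN hornerZ hornerM hornerX horner_sum.
have kE := krein_entries i1 j k l.
have -> : (p i).[E i1 k l] = E j k l by rewrite (pE i (leqnn i) k l iD').
have -> : \sum_(h < D.+1 | (h <= i)%N) (q h i1 j *: p h).[E i1 k l] =
    \sum_(h < D.+1 | (h <= i)%N) q h i1 j * E h k l.
  apply: eq_bigr => h hi; rewrite hornerZ; congr (_ * _).
  by rewrite -(pE h hi _ _ (ltn_ord h)); congr (E _ k l); apply: val_inj.
rewrite kE mulrA mulfV // mul1r (bigID (fun h : 'I_D.+1 => h <= i)%N) /= addrC.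
rewrite addrK (bigD1 j1) /= ?ltnn -?ltnNge // big1 ?addr0 ?mulKf //.
move=> h /andP[hi hj]; have [-> ] := q_poly h i1 j; first by rewrite mul0r.
by move: hi hj; rewrite -val_eqE /= i11; lia.
Qed.

Variables (x : X) (i1 : 'I_D.+1).
Hypothesis i1E : i1 = 1%N :> nat.

(** Up to the factor [#|X|] these are the dual eigenvalues. Where [E i1] takes equal values, so does
    every [E i] by [E_polynomial], and [E_separate] identifies the distances. *)
Lemma dual_eigenvalues : exists2 ths : 'I_D.+1 -> R, injective ths &
  forall k (j : 'I_D.+1), gdist e x (enum_val k) = j ->
    E i1 (enum_rank x) k = ths j.
Proof.
have [c cE] := E_entries; exists (c i1) => [a b cab|k j kj]; last first.
  by rewrite cE /d enum_rankK kj.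
have X0 : (0 < #|X|)%N by apply/card_gt0P; exists x.
have [k [l kl]] := vdist_onto (ltn_ord a) X0.
have [k' [l' kl']] := vdist_onto (ltn_ord b) X0.
apply: val_inj => /=; rewrite -kl -kl'; apply: E_separate => i.
have [p pE] := E_polynomial i1E i.
by rewrite !pE !cE kl kl' cab.
Qed.

Let F (b : bool) (i : 'I_D.+1) :=
  if b then E i else dual_idempotent R e x i.

Lemma family_sum b : \sum_i F b i = 1%:M.
Proof.
case: b => //=; apply/matrixP => k l; rewrite summxE mxE.
have kD : (gdist e x (enum_val k) < D.+1)%N by rewrite ltnS -e_diam gdist_le_diameter.
rewrite (bigD1 (Ordinal kD)) //= !mxE eqxx big1 ?addr0 // => j jk.
rewrite !mxE eq_sym (negPf (_ : (j : nat) != _)) ?mul0rn //.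
Qed.

Lemma family_mul b i j : F b i *m F b j = if i == j then F b i else 0.
Proof.
case: b => //=; rewrite /dual_idempotent mulmx_diag.
have [->|ij] := eqVneq i j.
  by congr diag_mx; apply/rowP => k; rewrite !mxE -natrM mulnb andbb.
rewrite -[RHS](linear0 (@diag_mx R #|X|)); congr diag_mx; apply/rowP => k.
rewrite !mxE -natrM mulnb; case: eqP => //= ->.
by rewrite -[_ == _ :> nat]/(i == j) (negPf ij).
Qed.

Lemma family_sym b i : (F b i)^T = F b i.
Proof. by case: b => /=; rewrite ?E_sym // tr_diag_mx. Qed.

Variable ths : 'I_D.+1 -> R.
Hypothesis ths_E : forall k (j : 'I_D.+1), gdist e x (enum_val k) = j ->
  E i1 (enum_rank x) k = ths j.

Let th (b : bool) := if b then theta else ths.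

Lemma speval_dual : speval th F false 'X = diag_mx (row (enum_rank x) (E i1)).
Proof.
apply/matrixP => k l; rewrite summxE !mxE.
have kD : (gdist e x (enum_val k) < D.+1)%N by rewrite ltnS -e_diam gdist_le_diameter.
rewrite (bigD1 (Ordinal kD)) //= !mxE eqxx hornerX (@ths_E k (Ordinal kD) erefl).
rewrite mulrnAr mulr1 big1 ?addr0 // => j jk.
by rewrite !mxE eq_sym (negPf (_ : (j : nat) != _)) ?mul0rn ?mulr0.
Qed.

(* The squared norm of E_j A* E_l is a multiple of the Krein parameter
   q^1_(j,l). *)
Lemma family_tri b (j l : 'I_D.+1) : (j.+1 < l)%N || (l.+1 < j)%N ->
  F b j *m speval th F (~~ b) 'X *m F b l = 0.
Proof.
move=> jl; case: b; last first.
  rewrite (_ : speval th F (~~ false) 'X = A); last exact: polX.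
  rewrite mul_mx_diag mul_diag_mx; apply/matrixP => k m; rewrite !mxE.
  case: eqP => [kj|_]; last by rewrite !mul0r.
  case: (boolP (e _ _)) => km; last by rewrite mulr0 mul0r.
  case: eqP => [ml|_]; last by rewrite mulr0.
  have mk : e (enum_val m) (enum_val k) by case: e_graph => -> .
  have := gdist_step e_graph x km; have := gdist_step e_graph x mk.
  by rewrite !(gdistC e_graph _ x) kj ml; move: jl; lia.
rewrite speval_dual /F; set u := row _ _; set Mx := _ *m _ *m _.
have q0 : q i1 j l = 0.
  by have [-> //] := q_poly i1 j l; move: jl; rewrite i1E; lia.
have MM : Mx *m Mx^T = E j *m diag_mx u *m E l *m diag_mx u *m E j.
  rewrite /Mx !trmx_mul !E_sym tr_diag_mx !mulmxA; congr (_ *m _ *m _).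
  by rewrite -[_ *m E l *m E l]mulmxA E_mul eqxx.
have tr0 : \tr (Mx *m Mx^T) = 0.
  rewrite MM mxtrace_mulC !mulmxA E_mul eqxx.
  pose kx := enum_rank x; have uE k : u 0 k = E i1 kx k by rewrite mxE.
  (* The double sum with [E h] is an entry of [E i1 *m E h *m E i1], so in the Krein expansion only
     [h = i1] survives, with coefficient [q i1 j l = 0]. *)
  have form h : \sum_k \sum_m u 0 k * E h k m * u 0 m = (E i1 *m E h *m E i1) kx kx.
    rewrite exchange_big [RHS]mxE; apply: eq_bigr => m _.
    rewrite [X in _ = X * _]mxE mulr_suml; apply: eq_bigr => k _.
    by rewrite !uE -[in E i1 m kx]E_sym [_^T m kx]mxE.
  transitivity (\sum_k \sum_m \sum_h
      #|X|%:R^-1 * q h j l * (u 0 k * E h k m * u 0 m)).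
    rewrite -mulmxA mul_mx_diag mul_mx_diag; apply: eq_bigr => k _.
    rewrite [LHS]mxE; apply: eq_bigr => m _.
    rewrite [X in X * _]mxE [X in _ * X]mxE -[in E l m k]E_sym [_^T m k]mxE.
    transitivity (u 0 k * (E j k m * E l k m) * u 0 m); first by ring.
    rewrite krein_entries !mulr_sumr mulr_suml; apply: eq_bigr => h _; ring.
  under eq_bigr do rewrite exchange_big.
  rewrite exchange_big big1 // => h _.
  have [->|hi1] := eqVneq h i1.
    by rewrite big1 // => k _; rewrite big1 // => m _; rewrite q0 mulr0 mul0r.
  under eq_bigr do rewrite -mulr_sumr.
  by rewrite -mulr_sumr form E_mul eq_sym (negPf hi1) mul0mx mxE mulr0.
clear MM; clearbody Mx.
apply/matrixP => k m; rewrite [RHS]mxE; apply/eqP; rewrite -sqrf_eq0.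
have row0 k' : (Mx *m Mx^T) k' k' = \sum_m' Mx k' m' ^+ 2.
  by rewrite mxE; apply: eq_bigr => m' _; rewrite [_^T m' k']mxE expr2.
move: tr0; rewrite /mxtrace; under eq_bigr do rewrite row0.
have sq_ge0 k' : 0 <= \sum_m' Mx k' m' ^+ 2.
  by apply: sumr_ge0 => m' _; apply: sqr_ge0.
move=> /(psumr_eq0P (fun k' _ => sq_ge0 k'))/(_ k isT)/psumr_eq0P -> //.
by move=> m' _; apply: sqr_ge0.
Qed.

End Krein.

End BoseMesner.
Local Open Scope complex_scope.

(** * Irreducibility passes to the complexification *)

Section Complexification.
Variables (R : realType) (n : nat).

Let cplx m p (M : 'M[R]_(m, p)) := map_mx (real_complex R) M.

Lemma cplx_rect_eq0 (a b : 'cV[R]_n) : cplx a + 'i *: cplx b = 0 -> a = 0 /\ b = 0.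
Proof.
move=> ab; have abk k : a k 0 = 0 /\ b k 0 = 0.
  move/colP/(_ k): ab; rewrite !mxE => /eqP; rewrite eq_complex /=.
  by rewrite !(mul0r, mul1r, mulr0, subr0, addr0, add0r) => /andP[/eqP -> /eqP ->].
by split; apply/colP => k; rewrite mxE; case: (abk k).
Qed.

Variables (G : 'M[R]_n -> Prop) (Gc : 'M[R[i]]_n -> Prop).
Hypothesis G_cplx : forall B, G B -> Gc (cplx B).
Hypothesis Gc_real : forall B, Gc B -> exists2 B0, G B0 & B = cplx B0.

Lemma complexification_irreducible (W : {vspace 'cV[R]_n}) (P : 'M[R]_n) u :
  irreducible_module (generated_subalgebra G) W ->
  generated_subalgebra G P -> u \in W -> u != 0 -> P *m u = u ->
  (forall w, w \in W -> exists c, P *m w = c *: u) ->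
  irreducible_module (generated_subalgebra Gc) (complexification W).
Proof.
move=> W_irr TP uW u0 Pu Pscal; have [WT _ _] := W_irr.
have T_cplx B : generated_subalgebra G B -> generated_subalgebra Gc (cplx B).
  elim=> [{}B /G_cplx GB||a {}B _ IH|{}B C _ IH _ IH'|{}B C _ IH _ IH'].
  - exact: gen_incl.
  - by rewrite /cplx map_mx1; apply: gen_one.
  - by rewrite /cplx map_mxZ; apply: gen_scale.
  - by rewrite /cplx map_mxD; apply: gen_add.
  by rewrite /cplx map_mxM; apply: gen_mul.
have cplxW w : w \in W -> cplx w \in complexification W.
  move=> wW; apply/complexificationP; exists w, 0; rewrite mem0v; split=> //.
  by rewrite map_mx0 scaler0 addr0.
have mulW B v : generated_subalgebra Gc B -> v \in complexification W ->
    B *m v \in complexification W.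
  move=> TB; elim: TB v =>
    [{}B /Gc_real[B0 GB0 ->]||a {}B _ IH|{}B C _ IH _ IH'|{}B C _ IH _ IH'] v vW.
  - have [a [b [aW bW ->]]] := (complexificationP W v).1 vW.
    apply/complexificationP; exists (B0 *m a), (B0 *m b).
    by rewrite !WT ?map_mxM ?mulmxDr ?scalemxAr //; apply: gen_incl.
  - by rewrite mul1mx.
  - by rewrite -scalemxAl memvZ ?IH.
  - by rewrite mulmxDl memvD ?IH ?IH'.
  by rewrite -mulmxA IH ?IH'.
split=> // [W0|U UT UW].
  move: (cplxW u uW); rewrite W0 memv0 => /eqP/matrixP cu0.
  case/negP: u0; apply/eqP/matrixP => k l; apply: complexI.
  by have := cu0 k l; rewrite !mxE.
have [[v vU Pv]|nPv] := EM (exists2 v, v \in U & cplx P *m v <> 0).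
  right; apply/eqP; rewrite eqEsubv UW /=; apply/subvP => w wW.
  have [a [b [aW bW vE]]] := (complexificationP W v).1 (subvP UW v vU).
  have [ca Pa] := Pscal a aW; have [cb Pb] := Pscal b bW.
  have PvE : cplx P *m v = (ca%:C + 'i * cb%:C) *: cplx u.
    rewrite vE mulmxDr -scalemxAr -!map_mxM Pa Pb !map_mxZ scalerDl.
    by congr (_ + _); apply: scalerA.
  have uU : cplx u \in U.
    have c0 : ca%:C + 'i * cb%:C != 0.
      by apply/eqP => c0; apply: Pv; rewrite PvE c0 scale0r.
    have : cplx P *m v \in U by apply: UT => //; apply: T_cplx.
    by rewrite PvE rpredZeq (negPf c0).
  have WU z : z \in W -> cplx z \in U.
    move=> /(irreducible_cyclic W_irr uW u0)[B TB ->].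
    by rewrite /cplx map_mxM; apply: UT => //; apply: T_cplx.
  have [a' [b' [aW' bW' ->]]] := (complexificationP W w).1 wW.
  by rewrite memvD ?memvZ ?WU.
left; apply/eqP; rewrite -subv0; apply/subvP => v vU; rewrite memv0.
have [a [b [aW bW vE]]] := (complexificationP W v).1 (subvP UW v vU).
(* [P] kills [B v]; as both matrices are real, the real and imaginary parts of [v] are killed
   separately. *)
have kill B : generated_subalgebra G B -> P *m (B *m a) = 0 /\ P *m (B *m b) = 0.
  move=> TB; apply: cplx_rect_eq0;
  rewrite /cplx !map_mxM scalemxAr scalemxAr -!mulmxDr -vE.
  apply: contrapT => PBv; apply: nPv; exists (cplx B *m v) => //.
  by apply: UT => //; apply: T_cplx.
(* A nonzero [z] would generate [u], which [P] fixes. *)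
have is0 z : z \in W ->
    (forall B, generated_subalgebra G B -> P *m (B *m z) = 0) -> z = 0.
  move=> zW Bz; apply/eqP/negPn/negP => z0; case/negP: u0.
  by have [B TB uE] := irreducible_cyclic W_irr zW z0 uW; rewrite -Pu uE Bz.
have a0 : a = 0 := is0 a aW (fun B TB => proj1 (kill B TB)).
have b0 : b = 0 := is0 b bW (fun B TB => proj2 (kill B TB)).
by rewrite vE a0 b0 !map_mx0 scaler0 addr0.
Qed.

End Complexification.

(** * From the graph to the tridiagonal pair *)

Lemma mem_leigenspace (F : fieldType) (n : nat) (A : 'M[F]_n) a (v : 'cV[F]_n) :
  v \in passmx.leigenspace (linfun (mulmx A)) a <-> A *m v = a *: v.
Proof.
rewrite memv_ker !lfun_simp /= subr_eq0.
by split=> [/eqP|->].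
Qed.

Lemma mem_leigenvalue (F : fieldType) (n : nat) (A : 'M[F]_n) a :
  passmx.leigenvalue (linfun (mulmx A) : 'End('cV[F]_n)) a <->
  exists2 v : 'cV[F]_n, v != 0 & A *m v = a *: v.
Proof.
rewrite /passmx.leigenvalue -vpick0; split=> [v0|[v v0 Av]].
  by exists (vpick (passmx.leigenspace (linfun (mulmx A)) a)) => //;
    apply/mem_leigenspace/memv_pick.
rewrite vpick0; apply: contra v0 => /eqP V0.
by rewrite -memv0 -V0; apply/mem_leigenspace.
Qed.

Lemma adjacency_sym (F : fieldType) (X : finType) (e : rel X) :
  symmetric e -> (adjacency F e)^T = adjacency F e.
Proof. by move=> e_sym; apply/matrixP => k l; rewrite !mxE e_sym. Qed.

Lemma adjacency_cplx (R : realType) (X : finType) (e : rel X) :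
  map_mx (real_complex R) (adjacency R e) = adjacency R[i] e.
Proof. by apply/matrixP => k l; rewrite !mxE rmorph_nat. Qed.

Lemma dual_idempotent_cplx (R : realType) (X : finType) (e : rel X) x i :
  map_mx (real_complex R) (dual_idempotent R e x i) = dual_idempotent R[i] e x i.
Proof. by apply/matrixP => k l; rewrite !mxE rmorphMn rmorph_nat. Qed.

Theorem theorem1p3 (R : realType) (X : finType) (e : rel X) (D : nat)
    (E : 'I_D.+1 -> 'M[R]_#|X|) (x : X) (W : {vspace 'cV[R]_#|X|}) :
  distance_regular e ->
  diameter e = D ->
  (3 <= D)%N ->
  primitive_idempotents e E ->
  Q_polynomial E ->
  irreducible_module (@terwilliger R X e x) W ->
  irreducible_module (@terwilliger R[i] X e x) (complexification W).
Proof.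
move=> e_drg e_diam D3 [theta [theta_inj A_eig _ E_proj]] [q q_krein q_poly] W_irr.
have D0 : (0 < D)%N by apply: leq_trans D3.
have A_sym : (adjacency R e)^T = adjacency R e.
  by apply: adjacency_sym; case: e_drg => -[].
have V_eig i v := @mem_leigenspace R #|X| (adjacency R e) (theta i) v.
have A_eigen a (v : 'cV[R]_#|X|) : v != 0 -> adjacency R e *m v = a *: v ->
    exists i, a = theta i.
  by move=> v0 Av; apply/A_eig/mem_leigenvalue; exists v.
have E_sum := primitive_sum A_sym theta_inj V_eig A_eigen E_proj.
have E_mul := primitive_mul A_sym theta_inj V_eig A_eigen E_proj.
have E_sym := primitive_sym A_sym theta_inj V_eig A_eigen E_proj.
have E_spec := primitive_spectral A_sym theta_inj V_eig A_eigen E_proj.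
have E_neq0 i : E i != 0.
  apply: (primitive_neq0 E_proj); have /mem_leigenvalue[v v0 Av] : passmx.leigenvalue
    (linfun (mulmx (adjacency R e)) : 'End('cV[R]_#|X|)) (theta i) by apply/A_eig; exists i.
  by exists v => //; apply/V_eig.
pose i1 : 'I_D.+1 := Ordinal (D0 : (1 < D.+1)%N).
have [ths ths_inj ths_E] := dual_eigenvalues e_drg e_diam D0 theta_inj E_sum
  E_mul E_sym E_spec E_neq0 q_krein q_poly x (erefl : i1 = 1%N :> nat).
pose th (b : bool) := if b then theta else ths.
pose F (b : bool) (i : 'I_D.+1) := if b then E i else dual_idempotent R e x i.
have th_inj b : injective (th b) by case: b.
have F_sum b : \sum_i F b i = 1%:M by apply: family_sum.
have F_mul b i j : F b i *m F b j = if i == j then F b i else 0.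
  exact: family_mul.
have F_sym b i : (F b i)^T = F b i by apply: family_sym.
have F_tri b (j l : 'I_D.+1) : (j.+1 < l)%N || (l.+1 < j)%N ->
    F b j *m speval th F (~~ b) 'X *m F b l = 0.
  exact: (family_tri e_drg e_diam D0 E_mul E_sym E_spec q_krein q_poly
    (erefl : i1 = 1%N :> nat) ths_E).
pose G (B : 'M[R]_#|X|) := B = adjacency R e \/
  exists2 i : nat, (i <= diameter e)%N & B = dual_idempotent R e x i.
have levX : speval th F true 'X = adjacency R e := polX E_spec.
have G_lev B : G B -> exists b p, B = speval th F b p.
  case=> [->|[i iD ->]]; first by exists true, 'X; rewrite levX.
  rewrite e_diam -ltnS in iD.
  have [p pE] := @speval_delta _ _ _ th F th_inj false (Ordinal iD).
  by exists false, p; rewrite -pE.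
(* The generators are [A] and the dual idempotents; the primitive idempotents lie in the algebra as
   polynomials in [A]. *)
have T_lev p : generated_subalgebra G (speval th F true p).
  elim/poly_ind: p => [|p c IH].
    by rewrite speval0 -(scale0r 1%:M); apply/gen_scale/gen_one.
  rewrite spevalD (@spevalM R _ D th F F_mul) levX
     -alg_polyC spevalZ (@speval1 R _ D th F F_sum).
  apply: gen_add; last by apply/gen_scale/gen_one.
  by apply: gen_mul => //; apply: gen_incl; left.
have G_F b i : generated_subalgebra G (F b i).
  case: b; first by have [p ->] := @speval_delta _ _ _ th F th_inj true i; apply: T_lev.
  by apply: gen_incl; right; exists i => //; rewrite e_diam -ltnS.
have [r [u [uW u0 ru rW]]] :=
  endpoint_dim1 th_inj F_sum F_mul F_sym F_tri G_lev G_F W_irr.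
apply: (complexification_irreducible _ _ W_irr (G_F false r) uW u0 ru rW).
- move=> B [->|[i iD ->]]; first by left; rewrite adjacency_cplx.
  by right; exists i => //; rewrite dual_idempotent_cplx.
move=> B [->|[i iD ->]].
  by exists (adjacency R e); [left | rewrite adjacency_cplx].
exists (dual_idempotent R e x i); last by rewrite dual_idempotent_cplx.
by right; exists i.
Qed.
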